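(* Let $K\in\mathbb R$, $N\in(1,\infty)$ and $D>0$, with $D\le\pi\sqrt{(N-1)/K}$ if $K>0$. Let $h:[0,D]\to\mathbb R$ be an $\mathsf{MCP}(K,N)$-density which integrates to $1$. Assume there exists $v\in(0,1)$ such that $\mathcal I_h(v)=\widetilde{\mathcal I}_{K,N,D}(v)$. Then either $h=h_{a_v}$ or $h=h_{a_{1-v}}$.
   Context: Put $\kappa=K/(N-1)$ and $s_\kappa(\theta)=\frac{1}{\sqrt\kappa}\sin(\sqrt\kappa\,\theta)$ if $\kappa>0$, $s_0(\theta)=\theta$, $s_\kappa(\theta)=\frac1{\sqrt{-\kappa}}\sinh(\sqrt{-\kappa}\,\theta)$ if $\kappa<0$. For $t\in[0,1]$: $\sigma^{(t)}_{K,N-1}(0)=t$; $\sigma^{(t)}_{K,N-1}(\theta)=s_\kappa(t\theta)/s_\kappa(\theta)$ for $\theta>0$ (and $\theta<\pi/\sqrt\kappa$ if $\kappa>0$); $\sigma^{(t)}_{K,N-1}(\theta)=+\infty$ if $\kappa>0$ and $\theta\ge\pi/\sqrt\kappa$. A non-negative Borel function $h:[0,D]\to\mathbb R$ is an $\mathsf{MCP}(K,N)$-density if $h(tx_1+(1-t)x_0)\ge\sigma^{(1-t)}_{K,N-1}(|x_1-x_0|)^{N-1}h(x_0)$ for all $x_0,x_1\in[0,D]$, $t\in[0,1]$ (convention $\infty\cdot0=0$). Such densities are taken to be continuous up to the boundary of $[0,D]$. For a measure $\mu$ on $\mathbb R$, $\mu^+(A)=\liminf_{\varepsilon\to0^+}\frac{\mu(A^\varepsilon)-\mu(A)}{\varepsilon}$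 with $A^\varepsilon=\{x:\mathrm{dist}(x,A)<\varepsilon\}$. For an integrable density $h$ on $[0,D]$ with integral $1$, $\mathcal I_h(v)=\inf\{(h\mathcal L^1)^+(A):A\subset[0,D]\text{ Borel},\ \int_Ah=v\}$. Define $\widetilde{\mathcal I}_{K,N,D}(v)=\inf\mathcal I_h(v)$, the infimum being over all $\mathsf{MCP}(K,N)$-densities $h:[0,D]\to\mathbb R$ integrating to $1$. For $a\in(0,D)$ put $$f_{K,N,D}(a)=\Big(\int_0^a\Big(\tfrac{s_\kappa(D-y)}{s_\kappa(D-a)}\Big)^{N-1}dy+\int_a^D\Big(\tfrac{s_\kappa(y)}{s_\kappa(a)}\Big)^{N-1}dy\Big)^{-1},$$ and let $h_a:[0,D]\to\mathbb R$ be $h_a(x)=f_{K,N,D}(a)\big(\tfrac{s_\kappa(D-x)}{s_\kappa(D-a)}\big)^{N-1}$ for $x\le a$, $h_a(x)=f_{K,N,D}(a)\big(\tfrac{s_\kappa(x)}{s_\kappa(a)}\big)^{N-1}$ for $x\ge a$. For $v\in(0,1)$, $a_v$ denotes the unique $a\in(0,D)$ with $\int_0^ah_a(x)\,dx=v$. *)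

(* Defs.v *)
From mathcomp Require Import all_boot all_order all_algebra.
From mathcomp Require Import all_classical all_reals all_analysis.
Set Implicit Arguments.
Unset Strict Implicit.
Unset Printing Implicit Defensive.
Import Order.TTheory GRing.Theory Num.Theory.
Import numFieldNormedType.Exports.
Local Open Scope classical_set_scope.
Local Open Scope ring_scope.

Definition sinh (R : realType) (x : R) : R := (expR x - expR (- x)) / 2.

Definition s_ (R : realType) (kappa theta : R) : R :=
  if 0 < kappa then sin (Num.sqrt kappa * theta) / Num.sqrt kappa
  else if kappa == 0 then theta
  else sinh (Num.sqrt (- kappa) * theta) / Num.sqrt (- kappa).

(* sigma K n t theta is $\sigma^{(t)}_{K,n}(\theta)$; it is used with
   n = N - 1, and then K / n is the constant kappa. *)
Definition sigma (R : realType) (K n t theta : R) : \bar R :=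
  let kappa := K / n in
  if theta == 0 then t%:E
  else if (0 < kappa) && (pi / Num.sqrt kappa <= theta) then +oo%E
  else (s_ kappa (t * theta) / s_ kappa theta)%:E.

(* A function on [0, D] is represented by a function on R, of which only the
   values on [0, D] matter. The inequality lives in \bar R, where
   +oo * 0 = 0. *)
Definition MCP_density (R : realType) (K N D : R) (h : R -> R) : Prop :=
  [/\ measurable_fun `[0, D] h,
      {within `[0, D], continuous h},
      (forall x, x \in `[0, D] -> 0 <= h x) &
      (forall x0 x1 t : R, x0 \in `[0, D] -> x1 \in `[0, D] -> t \in `[0, 1] ->
        ((sigma K (N - 1) (1 - t) `|x1 - x0|%R) `^ (N - 1) * (h x0)%:E
         <= (h (t * x1 + (1 - t) * x0)%R)%:E)%E)].

(* The measure h L^1, for h extended by 0 outside [0, D]. *)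
Definition density_measure (R : realType) (D : R) (h : R -> R) (A : set R)
    : \bar R :=
  (\int[lebesgue_measure]_(x in A `&` `[0%R, D]) (h x)%:E)%E.

Definition enlargement (R : realType) (A : set R) (e : R) : set R :=
  [set x | (edist_inf A x < e%:E)%E].

Definition outer_minkowski (R : realType) (mu : set R -> \bar R) (A : set R)
    : \bar R :=
  limf_einf (fun e : R => ((mu (enlargement A e) - mu A) * (e^-1)%:E)%E) 0^'+.

Definition iso_profile (R : realType) (D : R) (h : R -> R) (v : R) : \bar R :=
  ereal_inf [set outer_minkowski (density_measure D h) A | A in
    [set A : set R | [/\ measurable A, A `<=` `[0, D] &
                         density_measure D h A = v%:E]]].

Definition MCP_iso_profile (R : realType) (K N D v : R) : \bar R :=
  ereal_inf [set iso_profile D h v | h in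
    [set h : R -> R | MCP_density K N D h /\
                      density_measure D h `[0, D] = 1%E]].

Definition f_ (R : realType) (K N D a : R) : R :=
  let s := s_ (K / (N - 1)) in
  (\int[lebesgue_measure]_(y in `[0%R, a])
      ((s (D - y) / s (D - a)) `^ (N - 1))
   + \int[lebesgue_measure]_(y in `[a, D]) ((s y / s a) `^ (N - 1)))^-1.

Definition h_ (R : realType) (K N D a x : R) : R :=
  let s := s_ (K / (N - 1)) in
  if x <= a then f_ K N D a * (s (D - x) / s (D - a)) `^ (N - 1)
  else f_ K N D a * (s x / s a) `^ (N - 1).

(* xget selects an element of the set; the default 0 is only returned when
   there is none, and it is not in the interval ]0, D[. *)
Definition a_ (R : realType) (K N D v : R) : R :=
  xget 0 [set a : R | 0 < a < D /\
    \int[lebesgue_measure]_(x in `[0%R, a]) h_ K N D a x = v].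

(* Main.v *)
Require Import Defs.
From mathcomp Require Import all_boot all_order all_algebra.
From mathcomp Require Import all_classical all_reals all_analysis.
From mathcomp Require Import ring lra.
Import Order.TTheory GRing.Theory Num.Theory.
Import numFieldNormedType.Exports.
Local Open Scope classical_set_scope.
Local Open Scope ring_scope.
Set Implicit Arguments.
Unset Strict Implicit.
Unset Printing Implicit Defensive.

(** Why the theorem holds.

    Put w = s_kappa ^ (N - 1). The generalised sine satisfies Ptolemy's
    identity s(a+b) s(b+c) = s(a) s(c) + s(b) s(a+b+c), and the two
    inequalities between products of values of w that it yields, together with
    continuity and positivity, are all that is used of it ([mcp_weight]).

    The MCP condition with one end point at 0 or at D says that
    h(x) / w(D - x) is nondecreasing and h(x) / w(x) is nonincreasing
    ([MCP_comparison]). Hence the mass of h on the left of a is at most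
    h(a) L(a), and the mass on its right at most h(a) M(a), where L and M
    ([lmass], [rmass]) depend on the weight only; L increases and M decreases
    strictly, and M(a) = L(D - a). The point a = a_v is the one at which
    v / L(a) = (1 - v) / M(a), and c = 1 / (L(a) + M(a)) is the common value.
    The density h_a attains both bounds at a, so the half-line [0, a] shows
    that the infimum over all densities is at most c
    ([iso_profile_profile_le]). Conversely, if both bounds are attained at a
    by h, then h = h_a ([comparison_rigid]). So if h is neither h_a nor
    h_b, where b = a_{1-v} = D - a, then one of the two bounds is strict at a
    and one of them is strict at b. By continuity and by the strict
    monotonicity of L and M, there are then l < L(a) and r < M(a) such that,
    on one side of some threshold t near a, the mass on the left of y is at
    most l h(y), and on the other side, the mass on the right of y is at most
    r h(y); near b the same holds with l and r exchanged ([has_slack],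
    [slack_or_rigid]).

    It remains to see that this slack bounds the outer Minkowski content of
    every set A of mass v away from c, uniformly in A ([iso_profile_gap]).
    Let t and s be the thresholds near a and b, and let G be the set of the
    points at distance at least e from A. The e-enlargement adds to A the
    region between A and G, which contains an open interval of length e
    wherever a point of A is followed or preceded by a point of G. Call a point
    of A good if some point of G lies between it and t on its right, or between
    it and s on its left; call a point of G good if some point of A lies
    between it and s on its right, or between it and t on its left. Up to a
    small change of the thresholds, for which the margin in [has_slack] leaves
    room, either all points of A are good or all points of G are
    ([covering_dichotomy]). If all points of A are good, then two gaps
    suffice: the one after the last point that is good to the right, and the
    one before the first point that is good to the left. Every point of A lies
    behind one of them, and h is at least (mass behind the gap) / l on it, so the
    region between A and G has mass at least e v / l ([gap_mass]). The other
    case gives e (1 - v) / (r + o(1)) in the same way. Both quotients exceed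
    c by a margin that does not depend on A, which contradicts the equality
    of the two isoperimetric profiles. *)

(** * Integrals of continuous functions on segments *)

Section integrals.
Context {R : realType}.
Implicit Types (f g : R -> R) (a b c x : R).
Notation mu := (@lebesgue_measure R).

Lemma continuous_itv_integrable f a b :
  {within `[a, b], continuous f} -> mu.-integrable `[a, b] (EFin \o f).
Proof.
by move=> cf; apply: continuous_compact_integrable => //; exact: segment_compact.
Qed.

Lemma within_itvS f a b c d : a <= c -> d <= b ->
  {within `[a, b], continuous f} -> {within `[c, d], continuous f}.
Proof.
move=> ac db; apply: continuous_subspaceW => x /=.
by rewrite !in_itv/= => /andP[cx xd]; rewrite (le_trans ac)//= (le_trans xd).
Qed.

Lemma Rintegral_itv_split f a b c : a <= c -> c <= b ->
  {within `[a, b], continuous f} ->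
  \int[mu]_(x in `[a, b]) f x =
  \int[mu]_(x in `[a, c]) f x + \int[mu]_(x in `[c, b]) f x.
Proof.
move=> ac cb cf; have itf := continuous_itv_integrable cf.
rewrite -[X in _ = _ + X]Rintegral_itv_obnd_cbnd; last first.
  apply: integrableS itf => //.
  by move=> x /=; rewrite !in_itv/= => /andP[/ltW/(le_trans ac)->].
rewrite -(@Rintegral_itvB _ f (BLeft a) (BRight b) c) ?bnd_simp//.
by rewrite addrC subrK.
Qed.

Lemma le_Rintegral_itv f g a b :
  {within `[a, b], continuous f} -> {within `[a, b], continuous g} ->
  (forall x, a <= x <= b -> f x <= g x) ->
  \int[mu]_(x in `[a, b]) f x <= \int[mu]_(x in `[a, b]) g x.
Proof.
by move=> cf cg fg; apply: le_Rintegral => //; exact: continuous_itv_integrable.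
Qed.

Lemma Rintegral_itv_ge0 f a b : (forall x, a <= x <= b -> 0 <= f x) ->
  0 <= \int[mu]_(x in `[a, b]) f x.
Proof. by move=> f0; apply: Rintegral_ge0 => x /=; rewrite in_itv/=; exact: f0. Qed.

Lemma Rintegral_itvZr f a b k : {within `[a, b], continuous f} ->
  \int[mu]_(x in `[a, b]) (f x * k) = (\int[mu]_(x in `[a, b]) f x) * k.
Proof. by move=> cf; rewrite RintegralZr//; exact: continuous_itv_integrable. Qed.

Lemma Rintegral_itvZl f a b k : {within `[a, b], continuous f} ->
  \int[mu]_(x in `[a, b]) (k * f x) = k * (\int[mu]_(x in `[a, b]) f x).
Proof. by move=> cf; rewrite RintegralZl//; exact: continuous_itv_integrable. Qed.

Lemma eq_Rintegral_itv f g a b : (forall x, a <= x <= b -> f x = g x) ->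
  \int[mu]_(x in `[a, b]) f x = \int[mu]_(x in `[a, b]) g x.
Proof.
by move=> fg; apply: eq_Rintegral => x; rewrite inE/= in_itv/=; exact: fg.
Qed.

Lemma Rintegral_itv_reflect f a b c : a <= b -> continuous f ->
  \int[mu]_(x in `[a, b]) f (c - x) = \int[mu]_(x in `[c - b, c - a]) f x.
Proof.
move=> ab cf; pose F x : R := c - x.
have dF x : is_derive x 1 F (-1).
  rewrite /F (_ : -1 = 0 - 1 :> R); last by rewrite sub0r.
  exact: is_deriveB.
have DF : derive1 F = cst (-1)%R.
  by apply/funext => z; rewrite derive1E; apply: derive_val.
have cF : continuous F.
  move=> x; apply: differentiable_continuous; apply/derivable1_diffP.
  exact: ex_derive.
rewrite /Rintegral; congr fine; symmetry.
rewrite (@integration_by_substitution_decreasing _ F f a b)//.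
- apply: eq_integral => x _; congr EFin.
  by rewrite !fctE DF /= opprK mulr1.
- by move=> x y _ _; rewrite /F ltrD2l ltrN2.
- by rewrite DF => ? _; exact: cvg_cst.
- by rewrite DF; exact: is_cvg_cst.
- by rewrite DF; exact: is_cvg_cst.
- split=> //.
  + by apply: cvg_at_right_filter; exact: cF.
  + by apply: cvg_at_left_filter; exact: cF.
- exact: continuous_subspaceT.
Qed.

(** All the integrals over [a, x] vanish by monotonicity, hence so does their
    derivative, which is f in the open interval; the end points follow by
    continuity. *)
Lemma continuous_ge0_Rintegral_eq0 f a b : a < b ->
  {within `[a, b], continuous f} -> (forall x, a <= x <= b -> 0 <= f x) ->
  \int[mu]_(x in `[a, b]) f x = 0 -> forall x, a <= x <= b -> f x = 0.
Proof.
move=> ab cf f0 if0.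
have itf := continuous_itv_integrable cf.
have [ci ca cb] := (continuous_within_itvP _ ab).1 cf.
have F0 x : a <= x <= b -> \int[mu]_(t in `[a, x]) f t = 0.
  move=> /andP[ax xb]; apply/eqP; rewrite eq_le Rintegral_itv_ge0 ?andbT; last first.
    by move=> t /andP[at_ tx]; rewrite f0// at_ (le_trans tx).
  rewrite -if0 (@Rintegral_itv_split f a b x)// lerDl Rintegral_itv_ge0// => t /andP[xt tb].
  by rewrite f0// tb andbT (le_trans ax).
have fi x : x \in `]a, b[ -> f x = 0.
  move=> xab; have := xab; rewrite in_itv/= => /andP[ax xb].
  have [_ <-] := continuous_FTC1_closed xb itf ax (ci _ xab).
  rewrite derive1E; set F := (X in 'D_1 X x).
  rewrite (_ : 'D_1 F x = 'D_1 (cst 0 : R -> R) x); first exact: derive_val.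
  apply: near_eq_derive; near=> y; rewrite /F/= F0//; apply/andP; split; apply: ltW; near: y.
    exact: lt_nbhsr.
  exact: lt_nbhsl.
have lim0 F : ProperFilter F -> (\forall x \near F, x \in `]a, b[) -> f @ F --> (0 : R).
  move=> PF nF; apply: (@cvg_trans _ ((fun=> 0 : R) @ F)); last exact: cvg_cst.
  by apply: near_eq_cvg; near=> x; rewrite fi//; near: x.
move=> x /andP[ax xb].
have [->|xa] := eqVneq x a.
  apply: (cvg_unique _ ca); first exact: norm_hausdorff.
  by apply: lim0; near=> y; rewrite in_itv/=; apply/andP; split=> //; near: y;
    exact: nbhs_right_lt.
have [->|xb'] := eqVneq x b.
  apply: (cvg_unique _ cb); first exact: norm_hausdorff.
  by apply: lim0; near=> y; rewrite in_itv/=; apply/andP; split=> //; near: y;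
    exact: nbhs_left_gt.
by apply: fi; rewrite in_itv/= !lt_neqAle ax xb xb' eq_sym xa.
Unshelve. all: by end_near. Qed.

Lemma continuous_le_Rintegral_eq (f g : R -> R) (b c : R) : b < c ->
  {within `[b, c], continuous f} -> {within `[b, c], continuous g} ->
  (forall x : R, b <= x <= c -> f x <= g x) ->
  \int[mu]_(x in `[b, c]) f x = \int[mu]_(x in `[b, c]) g x ->
  forall x : R, b <= x <= c -> f x = g x.
Proof.
move=> bc cf cg fg ifg x xbc; apply/esym/eqP; rewrite -subr_eq0; apply/eqP.
apply: (@continuous_ge0_Rintegral_eq0 (fun x => g x - f x) b c) => //.
- by move=> y; exact: cvgB (cg y) (cf y).
- by move=> y /fg; rewrite subr_ge0.
- by rewrite RintegralB ?ifg ?subrr//; exact: continuous_itv_integrable.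
Qed.

End integrals.

Lemma Rintegral_itv_cst (R : realType) (a b c : R) : a <= b ->
  \int[@lebesgue_measure R]_(x in `[a, b]) c = c * (b - a).
Proof.
move=> ab; have mE : fine ((@lebesgue_measure R) `[a, b]%classic) = b - a.
  rewrite lebesgue_measure_itv/= lte_fin; case: ifPn => //.
  by rewrite -leNgt => ba; rewrite (@le_anti _ _ a b) ?subrr// ab.
by rewrite Rintegral_cst//; transitivity (c * (b - a)); last by []; rewrite -mE.
Qed.

Lemma continuous_gt0_near (R : realType) (g : R -> R) (a : R) :
  {for a, continuous g} -> 0 < g a ->
  exists2 d : R, 0 < d & forall y, `|y - a| < d -> 0 < g y.
Proof.
move=> cg ga; have : \forall y \near a, 0 < g y by exact: cvgr_gt cg _ ga.
move=> [d /= d0 hd]; exists d => // y yd; apply: hd.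
by rewrite /ball_/= distrC.
Qed.

(** * Weights and the masses they bound *)

(** The properties of w = s_kappa ^ (N - 1) on [0, D] that the proof uses. The
    last two are the consequences of Ptolemy's identity for the sides and
    diagonals determined by four points at consecutive distances a, b, c. The
    value w D may be positive or zero: it is zero exactly in the case
    D = pi / sqrt kappa. *)
Record mcp_weight (R : realType) (D : R) (w : R -> R) : Prop := MCPWeight {
  weight_continuous : continuous w ;
  weight_ge0 : forall x, 0 <= w x ;
  weight_gt0 : forall x, 0 < x < D -> 0 < w x ;
  weight_outer : forall a b c, 0 <= a -> 0 <= b -> 0 <= c -> a + b + c <= D ->
    w a * w c <= w (a + b) * w (b + c) ;
  weight_inner : forall a b c, 0 <= a -> 0 <= b -> 0 <= c -> a + b + c <= D ->
    w b * w (a + b + c) <= w (a + b) * w (b + c) }.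

Section weight.
Context {R : realType}.
Notation mu := (@lebesgue_measure R).

(** The integral over [0, a] of the largest function with value 1 at a that
    satisfies the comparison inequality; [rmass] is its mirror image. *)
Definition lmass (w : R -> R) (D a : R) : R :=
  \int[mu]_(y in `[0, a]) (w (D - y) / w (D - a)).

Definition rmass (w : R -> R) (D a : R) : R :=
  \int[mu]_(y in `[a, D]) (w y / w a).

Variables (D : R) (w : R -> R).
Hypothesis hw : mcp_weight D w.

Let wc : continuous w := weight_continuous hw.

Lemma weight_comp_continuous (k : R) (f : R -> R) : continuous f ->
  continuous (fun y => w (f y) * k).
Proof.
move=> cf x; apply: cvgM; last exact: cvg_cst.
by apply: continuous_comp; [exact: cf|exact: wc].
Qed.

Lemma continuous_weightM (k : R) : continuous (fun y => w y * k).
Proof. by apply: (@weight_comp_continuous k id) => x; exact: cvg_id. Qed.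

Lemma continuous_weightB (c k : R) : continuous (fun y => w (c - y) * k).
Proof.
apply: weight_comp_continuous => x.
by apply: cvgB; [exact: cvg_cst|exact: cvg_id].
Qed.

Lemma continuous_weightD (c k : R) : continuous (fun y => w (c + y) * k).
Proof.
apply: weight_comp_continuous => x.
by apply: cvgD; [exact: cvg_cst|exact: cvg_id].
Qed.

(** The weight is log-concave, which is the inner inequality for the
    consecutive distances c' - c, c and u. When c' = D and w D = 0 the left-hand
    side is 0, as division by zero gives 0. *)
Lemma weight_ratio_le (c c' u : R) : 0 < c -> c <= c' -> 0 <= u ->
  c' + u <= D -> w (c' + u) / w c' <= w (c + u) / w c.
Proof.
move=> c0 cc' u0 c'uD.
have [wc'0|wc'0] := eqVneq (w c') 0.
  by rewrite wc'0 invr0 mulr0 divr_ge0 ?(weight_ge0 hw).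
have {}wc'0 : 0 < w c' by rewrite lt_neqAle eq_sym wc'0 (weight_ge0 hw).
have [->//|cc'N] := eqVneq c c'.
have wc0 : 0 < w c.
  by apply: (weight_gt0 hw); rewrite c0 (lt_le_trans _ c'uD)// ltr_wpDr// lt_neqAle cc'N.
rewrite ler_pdivrMr// mulrAC ler_pdivlMr//.
have := @weight_inner _ _ _ hw (c' - c) c u.
rewrite subrK (mulrC (w c)) (mulrC (w c')); apply; lra.
Qed.

(** Measuring positions from a instead of 0 makes the integrand monotone in a,
    which is what the strict monotonicity of [lmass] rests on. *)
Lemma lmass_shift a : 0 <= a ->
  lmass w D a = \int[mu]_(u in `[0, a]) (w (D - a + u) / w (D - a)).
Proof.
move=> a0.
have := @Rintegral_itv_reflect R (fun y => w (D - y) / w (D - a)) 0 a a a0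
  (@continuous_weightB D _).
rewrite subrr subr0 /lmass => <-.
by apply: eq_Rintegral_itv => x _; rewrite opprB addrA addrAC.
Qed.

Lemma rmass_lmass a : 0 < a < D -> rmass w D a = lmass w D (D - a).
Proof.
move=> /andP[a0 aD].
have := @Rintegral_itv_reflect R (fun y => w (0 + y) / w a) 0 (D - a) D _
  (@continuous_weightD 0 _).
rewrite subr0 /lmass !opprB addrCA subrr addr0 => h; apply/esym.
under eq_Rintegral do rewrite -[D - _]add0r.
rewrite h; first by apply: eq_Rintegral_itv => x _; rewrite add0r.
by rewrite subr_ge0 ltW.
Qed.

Lemma lmass_lt a b : 0 <= a -> a < b -> b < D -> lmass w D a < lmass w D b.
Proof.
move=> a0 ab bD; have b0 : 0 < b by exact: le_lt_trans ab.
have wb0 : 0 < w (D - b) by apply: (weight_gt0 hw); lra.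
have ct c k x y : {within `[x, y], continuous (fun u => w (c + u) * k)}.
  by apply: continuous_subspaceT; exact: continuous_weightD.
rewrite !lmass_shift ?(ltW b0)// (@Rintegral_itv_split _ _ 0 b a)// ?(ltW ab)//.
rewrite -[ltLHS]addr0; apply: ler_ltD.
  by apply: le_Rintegral_itv => // x /andP[x0 xa]; apply: weight_ratio_le; lra.
rewrite lt_neqAle Rintegral_itv_ge0 ?andbT; last first.
  by move=> x _; rewrite divr_ge0 ?(weight_ge0 hw).
apply/eqP => /esym i0.
have := continuous_ge0_Rintegral_eq0 ab (ct _ _ _ _)
  (fun x _ => divr_ge0 (weight_ge0 hw _) (weight_ge0 hw _)) i0 (x := (a + b) / 2).
move=> /(_ ltac:(lra)) /eqP.
rewrite mulf_eq0 invr_eq0 (gt_eqF wb0) orbF gt_eqF//.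
by apply: (weight_gt0 hw); lra.
Qed.

Lemma lmass_gt0 a : 0 < a < D -> 0 < lmass w D a.
Proof.
move=> /andP[a0 aD]; rewrite (le_lt_trans _ (@lmass_lt 0 a _ _ _))//.
by apply: Rintegral_itv_ge0 => x _; rewrite divr_ge0 ?(weight_ge0 hw).
Qed.

Lemma rmass_gt0 a : 0 < a < D -> 0 < rmass w D a.
Proof. by move=> aD; rewrite rmass_lmass// lmass_gt0//; lra. Qed.

Lemma rmass_lt a b : 0 < a -> a < b -> b < D -> rmass w D b < rmass w D a.
Proof. by move=> a0 ab bD; rewrite !rmass_lmass ?lmass_lt//; lra. Qed.

(** The bound D / 2 keeps w (D - a) away from 0 even if w D = 0: by
    [weight_ratio_le] the integrands for a <= D / 2 are all dominated by the
    one for D / 2. *)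
Lemma lmass_small e : 0 < D -> 0 < e -> exists2 a, 0 < a < D / 2 & lmass w D a < e.
Proof.
move=> D0 e0; pose g u := w (D / 2 + u) / w (D / 2).
have cg : {within `[0, D], continuous g}.
  by apply: continuous_subspaceT; exact: continuous_weightD.
have := parameterized_integral_near_left D0 e0 (continuous_itv_integrable cg).
move=> [d /= d0 hd].
pose a := Num.min (d / 2) (D / 4).
have a0 : 0 < a by rewrite lt_min; apply/andP; split; lra.
have ad : a <= d / 2 by rewrite ge_min lexx.
have aD : a <= D / 4 by rewrite ge_min lexx orbT.
clearbody a; exists a; first by apply/andP; split => //; lra.
apply: le_lt_trans (_ : parameterized_integral mu 0 a g < e); last first.
  apply: le_lt_trans (hd a _ (ltW a0)); first exact: ler_norm.
  by rewrite /ball_/= sub0r normrN gtr0_norm//; lra.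
rewrite lmass_shift ?(ltW a0)//; apply: le_Rintegral_itv.
- by apply: continuous_subspaceT; exact: continuous_weightD.
- by apply: continuous_subspaceT; exact: continuous_weightD.
- move=> x /andP[x0 xa]; rewrite /g; apply: weight_ratio_le; lra.
Qed.

Lemma lmass_continuous a b : 0 < a -> b < D ->
  {within `[a, b], continuous (lmass w D)}.
Proof.
move=> a0 bD.
have [ab|ab] := leP a b; last first.
  by rewrite set_itv_ge ?bnd_simp -?ltNge//; exact: continuous_subspace0.
pose F x := parameterized_integral mu 0 x (fun y => w (D - y) * 1).
have cF : {within `[a, b], continuous F}.
  apply: (@within_itvS _ _ 0 b) => //; [exact: ltW|]; apply: parameterized_integral_continuous.
    exact: ltW (lt_le_trans a0 ab).
  by apply: continuous_itv_integrable; apply: continuous_subspaceT; exact: continuous_weightB.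
have lE x : lmass w D x = F x / w (D - x).
  rewrite /F /parameterized_integral -Rintegral_itvZr; last first.
    by apply: continuous_subspaceT; exact: continuous_weightB.
  by apply: eq_Rintegral_itv => y _; rewrite mulr1.
rewrite (funext lE).
have cG : {within `[a, b], continuous (fun x => (w (D - x))^-1)}.
  apply: continuous_in_subspaceT => x /set_mem /=.
  rewrite in_itv/= => /andP[ax xb]; apply: cvgV.
    by rewrite gt_eqF//; apply: (weight_gt0 hw); lra.
  rewrite -[w (D - x)]mulr1; under eq_fun do rewrite -[w _]mulr1.
  exact: continuous_weightB.
by move=> x; exact: cvgM (cF x) (cG x).
Qed.

End weight.

(** * The balance point and the comparison of densities *)

Section balance.
Context {R : realType}.
Variables (D : R) (w : R -> R).
Hypothesis hw : mcp_weight D w.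

Lemma lmass_continuous_at x : 0 < x < D -> {for x, continuous (lmass w D)}.
Proof.
move=> /andP[x0 xD].
apply: (@within_continuous_continuous _ _ _ (x / 2) ((x + D) / 2)).
- lra.
- apply: (lmass_continuous hw); lra.
- by rewrite in_itv/=; apply/andP; split; lra.
Qed.

(** The difference of the two sides is continuous, negative where [lmass] is
    small, and positive at the mirror image of such a point. *)
Lemma balance_exists v : 0 < D -> 0 < v < 1 ->
  exists2 a, 0 < a < D & (1 - v) * lmass w D a = v * rmass w D a.
Proof.
move=> D0 /andP[v0 v1]; pose m := lmass w D (D / 2).
have m0 : 0 < m by apply: lmass_gt0 => //; lra.
have [b /andP[b0 bD] lb] : exists2 a, 0 < a < D / 2 &
    lmass w D a < Num.min (v * m) ((1 - v) * m).
  by apply: lmass_small => //; rewrite lt_min !mulr_gt0// subr_gt0.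
move: lb; rewrite lt_min => /andP[lbv lb1v].
have lb0 : 0 < lmass w D b by apply: lmass_gt0 => //; lra.
have mb : m < lmass w D (D - b) by apply: lmass_lt => //; lra.
pose phi a := (1 - v) * lmass w D a - v * lmass w D (D - a).
have [a] : exists2 a, a \in `[b, D - b] & phi a = 0.
  apply: IVT; first lra.
    apply: continuous_in_subspaceT => x /set_mem /=.
    rewrite in_itv/= => /andP[bx xb].
    apply: cvgB; apply: cvgM; [exact: cvg_cst| |exact: cvg_cst|].
      by apply: lmass_continuous_at; lra.
    apply: (@continuous_comp _ _ _ (fun y => D - y) (lmass w D)).
      by apply: cvgB; [exact: cvg_cst|exact: cvg_id].
    by apply: lmass_continuous_at; lra.
  have vb : v * m <= v * lmass w D (D - b) by rewrite ler_pM2l// ltW.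
  have vb' : (1 - v) * m <= (1 - v) * lmass w D (D - b).
    by rewrite ler_pM2l ?subr_gt0// ltW.
  have p1 : phi b <= 0 by rewrite /phi; nra.
  have p2 : 0 <= phi (D - b) by rewrite /phi opprB addrCA subrr addr0; nra.
  by rewrite ge_min p1 le_max p2 orbT.
rewrite in_itv/= => /andP[ba ab] /eqP; rewrite subr_eq0 => /eqP pa.
by exists a; [lra|rewrite (rmass_lmass hw)//; lra].
Qed.

Lemma balance_unique v a b : 0 < v < 1 -> 0 < a < D -> 0 < b < D ->
  (1 - v) * lmass w D a = v * rmass w D a ->
  (1 - v) * lmass w D b = v * rmass w D b -> a = b.
Proof.
move=> /andP[v0 v1].
wlog ab : a b / a < b.
  move=> H aD bD ea eb; have [ab|ba|//] := ltgtP a b; first exact: H.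
  exact/esym/H.
move=> /andP[a0 aD] /andP[b0 bD] ea eb.
have l := lmass_lt hw (ltW a0) ab bD; have r := rmass_lt hw a0 ab bD.
have : (1 - v) * lmass w D a < (1 - v) * lmass w D b by rewrite ltr_pM2l// subr_gt0.
by rewrite ea eb ltr_pM2l// ltNge (ltW r).
Qed.

End balance.

Section comparison.
Context {R : realType}.
Variables (D : R) (w h : R -> R).
Hypothesis hw : mcp_weight D w.
Notation mu := (@lebesgue_measure R).

(** The inequalities h x / w (D - x) <= h y / w (D - y) and
    h y / w y <= h x / w x for x <= y, multiplied out because the weight may
    vanish at the end points. *)
Record mcp_comparison : Prop := McpComparison {
  comparison_left : forall x y : R, 0 <= x -> x <= y -> y <= D ->
    h x * w (D - y) <= h y * w (D - x) ;
  comparison_right : forall x y : R, 0 <= x -> x <= y -> y <= D ->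
    h y * w x <= h x * w y }.

Hypothesis hh : mcp_comparison.
Hypothesis ch : {within `[0, D], continuous h}.

Variable a : R.
Hypothesis aD : 0 < a < D.

Let a0 : 0 < a. Proof. by case/andP: aD. Qed.
Let ltaD : a < D. Proof. by case/andP: aD. Qed.
Let wa : 0 < w a. Proof. exact: (weight_gt0 hw). Qed.
Let wDa : 0 < w (D - a). Proof. by apply: (weight_gt0 hw); move: a0 ltaD; lra. Qed.

Let chl : {within `[0, a], continuous h}.
Proof. by apply: within_itvS ch => //; exact: ltW. Qed.

Let chr : {within `[a, D], continuous h}.
Proof. by apply: within_itvS ch => //; exact: ltW. Qed.

Let cl k : {within `[0, a], continuous (fun x : R => k * (w (D - x) / w (D - a)))}.
Proof.
apply: continuous_subspaceT => x; apply: cvgM; first exact: cvg_cst.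
exact: (continuous_weightB hw).
Qed.

Let cr k : {within `[a, D], continuous (fun x : R => k * (w x / w a))}.
Proof.
apply: continuous_subspaceT => x; apply: cvgM; first exact: cvg_cst.
exact: (continuous_weightM hw).
Qed.

Let cl1 : {within `[0, a], continuous (fun x : R => w (D - x) / w (D - a))}.
Proof. by apply: continuous_subspaceT; exact: (continuous_weightB hw). Qed.

Let cr1 : {within `[a, D], continuous (fun x : R => w x / w a)}.
Proof.
apply: continuous_subspaceT.
exact: (continuous_weightM hw).
Qed.

Lemma comparison_le_left (x : R) : 0 <= x <= a -> h x <= h a * (w (D - x) / w (D - a)).
Proof.
move=> /andP[x0 xa]; rewrite mulrA ler_pdivlMr//.
by apply: (comparison_left hh) => //; exact: ltW.
Qed.

Lemma comparison_le_right (x : R) : a <= x <= D -> h x <= h a * (w x / w a).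
Proof.
move=> /andP[ax xD]; rewrite mulrA ler_pdivlMr//.
by apply: (comparison_right hh) => //; exact: ltW.
Qed.

Lemma Rintegral_le_lmass : \int[mu]_(x in `[0, a]) h x <= h a * lmass w D a.
Proof.
rewrite /lmass -Rintegral_itvZl//.
by apply: le_Rintegral_itv => //; exact: comparison_le_left.
Qed.

Lemma Rintegral_le_rmass : \int[mu]_(x in `[a, D]) h x <= h a * rmass w D a.
Proof.
rewrite /rmass -Rintegral_itvZl//.
by apply: le_Rintegral_itv => //; exact: comparison_le_right.
Qed.

(** If both mass bounds at a are attained, then the pointwise bounds of which
    they are the integrals are equalities, by continuity of h. *)
Lemma comparison_rigid :
  \int[mu]_(x in `[0, a]) h x = h a * lmass w D a ->
  \int[mu]_(x in `[a, D]) h x = h a * rmass w D a ->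
  forall x : R, 0 <= x <= D ->
  h x = h a * (if x <= a then w (D - x) / w (D - a) else w x / w a).
Proof.
rewrite /lmass /rmass -!Rintegral_itvZl// => il ir x /andP[x0 xD].
case: ifPn => [xa|]; last rewrite -ltNge => ax.
  apply: (continuous_le_Rintegral_eq a0 chl (@cl (h a)) (@comparison_le_left) il).
  by rewrite x0.
apply: (continuous_le_Rintegral_eq ltaD chr (@cr (h a)) (@comparison_le_right) ir).
by rewrite xD ltW.
Qed.

End comparison.

(** * Strict inequalities persist near the balance point *)

Section slack.
Context {R : realType}.
Variables (D : R) (w h : R -> R).
Hypothesis hw : mcp_weight D w.
Hypothesis hh : mcp_comparison D w h.
Hypothesis ch : {within `[0, D], continuous h}.
Hypothesis h0 : forall x : R, 0 <= x <= D -> 0 <= h x.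
Notation mu := (@lebesgue_measure R).
Let lh (y : R) := \int[mu]_(x in `[0, y]) h x.
Let rh (y : R) := \int[mu]_(x in `[y, D]) h x.

Lemma Rintegral_le_lmass_mono (b y : R) : 0 < b < D -> 0 <= y <= b ->
  lh y <= lmass w D b * h y.
Proof.
move=> /andP[b0 bD] /andP[y0 yb]; rewrite /lh.
have hy : 0 <= h y by rewrite h0// y0 ltW// (le_lt_trans yb).
move: y0; rewrite le_eqVlt => /predU1P[<-|y0].
  rewrite set_itv1 Rintegral_set1 mulr_ge0//; last by apply: h0; lra.
  by apply/ltW/lmass_gt0 => //; rewrite b0.
have yD : y < D by lra.
apply: le_trans (Rintegral_le_lmass hw hh ch _) _; first by rewrite y0.
rewrite mulrC ler_wpM2r//.
move: yb; rewrite le_eqVlt => /predU1P[->//|yb].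
by apply/ltW/lmass_lt => //; exact: ltW.
Qed.

Lemma Rintegral_le_rmass_mono (b y : R) : 0 < b < D -> b <= y <= D ->
  rh y <= rmass w D b * h y.
Proof.
move=> /andP[b0 bD] /andP[yb yD]; rewrite /rh.
have hy : 0 <= h y by rewrite h0// yD (le_trans (ltW b0)).
move: yD; rewrite le_eqVlt => /predU1P[->|yD].
  rewrite set_itv1 Rintegral_set1 mulr_ge0//; last by apply: h0; lra.
  by apply/ltW/rmass_gt0 => //; rewrite b0.
apply: le_trans (Rintegral_le_rmass hw hh ch _) _; first by rewrite yD (lt_le_trans b0).
rewrite mulrC ler_wpM2r//.
move: yb; rewrite le_eqVlt => /predU1P[->//|yb].
by apply/ltW/rmass_lt.
Qed.

(** Constants l < L and r < Rr, and a threshold t with a margin e around it,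
    such that left masses are controlled by l up to slightly beyond t, and
    right masses by r from t on. With L = [lmass w D a] and Rr = [rmass w D a],
    the comparison inequalities alone only give l = L and r = Rr, with t = a
    and no margin. *)
Definition has_slack (L Rr : R) := exists t e l r : R,
  [/\ 0 < e, 0 < l < L, 0 < r < Rr,
    forall y, 0 <= y <= D -> y <= t + e -> lh y <= l * h y &
    forall y, 0 <= y <= D -> t <= y -> rh y <= r * h y].

(** A strict inequality F a < h a * M leaves room for a constant below M, and
    then for a neighbourhood of a, F being the left or the right mass. *)
Let local_slack (F : R -> R) (a M : R) : 0 < a < D -> 0 <= F a ->
  {within `[0, D], continuous F} -> F a < h a * M -> 0 < M ->
  exists d l : R, [/\ 0 < d, 0 < l < M, 0 <= a - d, a + d <= D &
    forall y, `|y - a| <= d -> F y <= l * h y].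
Proof.
move=> aD Fa cF FM M0.
have ha : 0 < h a.
  rewrite lt_neqAle eq_sym h0 ?andbT; last by lra.
  by apply/eqP => ha0; move: FM; rewrite ha0 mul0r ltNge Fa.
pose q := F a / h a.
have q0 : 0 <= q by rewrite divr_ge0// ltW.
have qM : q < M by rewrite ltr_pdivrMr// mulrC.
pose l := (q + M) / 2.
have D0 : 0 < D by lra.
have [d d0 hd] : exists2 d : R, 0 < d & forall y, `|y - a| < d -> 0 < l * h y - F y.
  apply: continuous_gt0_near.
    have aD' : a \in `]0, D[ by rewrite in_itv.
    have := within_continuous_continuous D0 ch aD'.
    have := within_continuous_continuous D0 cF aD' => cFa cha.
    by apply: cvgB => //; apply: cvgM => //; exact: cvg_cst.
  have -> : F a = q * h a by rewrite divfK ?gt_eqF.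
  by rewrite -mulrBl mulr_gt0// /l; lra.
exists (Num.min (d / 2) (Num.min a (D - a))), l.
have md : Num.min (d / 2) (Num.min a (D - a)) <= d / 2 by rewrite ge_min lexx.
have ma : Num.min (d / 2) (Num.min a (D - a)) <= a by rewrite !ge_min lexx orbT.
have mD : Num.min (d / 2) (Num.min a (D - a)) <= D - a by rewrite !ge_min lexx !orbT.
have m0 : 0 < Num.min (d / 2) (Num.min a (D - a)) by rewrite !lt_min; lra.
split; [by []|rewrite /l; lra|lra|lra|].
by move=> y ya; rewrite ltW// -subr_gt0 hd//; lra.
Qed.

(** Strictness on the left at a allows the threshold to be moved to the right
    of a: there the right masses gain from the strict monotonicity of
    [rmass], and the left masses are controlled up to and beyond the threshold
    by [local_slack] near a, and by the monotonicity of [lmass] far from a. *)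
Lemma slack_left (a : R) : 0 < a < D -> lh a < h a * lmass w D a ->
  has_slack (lmass w D a) (rmass w D a).
Proof.
move=> aD la.
have [|||d [l [d0 lM ad aDd hd]]] := @local_slack lh a _ aD _ _ la.
- by apply: Rintegral_itv_ge0 => x xa; apply: h0; lra.
- by apply: parameterized_integral_continuous; [lra|exact: continuous_itv_integrable].
- exact: lmass_gt0.
(* The margin ends at a + d / 2, still within distance d of a. *)
exists (a + d / 4), (d / 4), (Num.max l (lmass w D (a - d / 2))), (rmass w D (a + d / 4)).
have r1 := @rmass_lt _ _ _ hw a (a + d / 4).
have r0 := @rmass_gt0 _ _ _ hw (a + d / 4).
have l1 := @lmass_lt _ _ _ hw (a - d / 2) a.
split.
- lra.
- by rewrite lt_max gt_max (andP lM).1 (andP lM).2 l1//; lra.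
- by rewrite r0 ?r1//; lra.
- move=> y yD ya; have [yad|yad] := leP y (a - d / 2).
    apply: le_trans (@Rintegral_le_lmass_mono (a - d / 2) y _ _) _; [lra|lra|].
    by rewrite ler_wpM2r ?h0// le_max lexx orbT.
  apply: le_trans (hd _ _) _; first by rewrite ler_norml; lra.
  by rewrite ler_wpM2r ?h0// le_max lexx.
- by move=> y yD ya; apply: Rintegral_le_rmass_mono; lra.
Qed.

Lemma slack_right (a : R) : 0 < a < D -> rh a < h a * rmass w D a ->
  has_slack (lmass w D a) (rmass w D a).
Proof.
move=> aD ra.
have [|||d [r [d0 rM ad aDd hd]]] := @local_slack rh a _ aD _ _ ra.
- by apply: Rintegral_itv_ge0 => x xa; apply: h0; lra.
- apply: (@subspace_eq_continuous _ _ _ (fun y => lh D - lh y)).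
    move=> y /set_mem /=; rewrite in_itv/= => /andP[y0 yD].
    by rewrite /lh (Rintegral_itv_split y0 yD ch) addrAC subrr add0r.
  move=> x; apply: cvgB; first exact: cvg_cst.
  by apply: parameterized_integral_continuous; [lra|exact: continuous_itv_integrable].
- exact: rmass_gt0.
(* The margin ends at a - d / 4, where the left masses gain from [lmass_lt]. *)
exists (a - d / 2), (d / 4), (lmass w D (a - d / 4)), (Num.max r (rmass w D (a + d / 4))).
have l1 := @lmass_lt _ _ _ hw (a - d / 4) a.
have l0 := @lmass_gt0 _ _ _ hw (a - d / 4).
have r1 := @rmass_lt _ _ _ hw a (a + d / 4).
split.
- lra.
- by rewrite l0 ?l1//; lra.
- by rewrite lt_max gt_max (andP rM).1 (andP rM).2 r1//; lra.
- by move=> y yD ya; apply: Rintegral_le_lmass_mono; lra.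
- move=> y yD ya; have [yad|yad] := leP (a + d / 4) y.
    apply: le_trans (@Rintegral_le_rmass_mono (a + d / 4) y _ _) _; [lra|lra|].
    by rewrite ler_wpM2r ?h0// le_max lexx orbT.
  apply: le_trans (hd _ _) _; first by rewrite ler_norml; lra.
  by rewrite ler_wpM2r ?h0// le_max lexx.
Qed.

End slack.

(** * Gaps between separated sets, and masses of sets *)

Definition apart (R : realType) (A G : set R) (e : R) :=
  forall z w, A z -> G w -> e <= `|z - w|.

(** The point x is the supremum of the points of A that see G on their right
    before t, and ]x, x + e[ is the gap behind x: no point of A lies between x
    and w0, and no point of G lies at distance less than e from x. The last
    clause is what makes the gaps on both sides disjoint in [gap_mass]. *)
Lemma gap_right (R : realType) (A G : set R) (e t : R) : 0 < e ->
  apart A G e ->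
  (exists z, A z /\ exists w, G w /\ z <= w <= t) ->
  exists x w0 : R, [/\ forall z, A z -> (exists w, G w /\ z <= w <= t) -> z <= x,
    G w0 /\ x + e <= w0 <= t,
    forall z, A z -> z <= w0 -> z <= x,
    forall w, G w -> e <= `|x - w| &
    forall d, 0 < d -> exists z, [/\ A z, z <= x & x - d < z] ].
Proof.
move=> e0 sep [z1 [Az1 [w1 [Gw1 /andP[z1w1 w1t]]]]].
pose S := [set z | A z /\ exists w, G w /\ z <= w <= t].
have S1 : S z1 by split => //; exists w1; rewrite z1w1.
have supS : has_sup S.
  split; first by exists z1.
  by exists t => z [_ [w [_ /andP[]]]]; exact: le_trans.
pose x := sup S.
have Sx z : S z -> z <= x by apply: ub_le_sup; case: supS.
have adh d : 0 < d -> exists2 z, S z & x - d < z by move=> d0; exact: sup_adherent.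
have sepx w : G w -> e <= `|x - w|.
  move=> Gw; rewrite leNgt; apply/negP => xw.
  have [z Sz zx] := adh (e - `|x - w|) ltac:(by rewrite subr_gt0).
  have := sep z w Sz.1 Gw; have zx' := Sx _ Sz.
  have : `|z - w| <= `|z - x| + `|x - w| by exact: ler_distD.
  by rewrite (@ler0_norm _ (z - x)); [move=> *; lra|lra].
have [z [Az [w0 [Gw0 /andP[zw0 w0t]]]] zx] := adh e e0.
have xw0 : x + e <= w0.
  have := sepx w0 Gw0; have [wx|wx] := leP w0 x.
    by rewrite ger0_norm; [move=> *; lra|lra].
  by rewrite ltr0_norm; [move=> *; lra|lra].
exists x, w0; split => //.
- by move=> z' Az' h'; apply: Sx.
- by rewrite xw0.
- by move=> z' Az' z'w; apply: Sx; split => //; exists w0; rewrite z'w.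
- by move=> d /adh[z' Sz' zz']; exists z'; split => //; [case: Sz'|exact: Sx].
Qed.

Lemma gap_left (R : realType) (A G : set R) (e s : R) : 0 < e ->
  apart A G e ->
  (exists z, A z /\ exists w, G w /\ s <= w <= z) ->
  exists x w0 : R, [/\ forall z, A z -> (exists w, G w /\ s <= w <= z) -> x <= z,
    G w0 /\ s <= w0 <= x - e,
    forall z, A z -> w0 <= z -> x <= z,
    forall w, G w -> e <= `|x - w| &
    forall d, 0 < d -> exists z, [/\ A z, x <= z & z < x + d] ].
Proof.
move=> e0 sep [z1 [Az1 [w1 [Gw1 /andP[sw1 wz1]]]]].
have [||x [w0 [h1 [h2 /andP[h3 h3']] h4 h5 h6]]] :=
    @gap_right R (-%R @` A) (-%R @` G) e (- s) e0.
- move=> _ _ [z Az <-] [w Gw <-].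
  by rewrite -opprD normrN; exact: sep.
- exists (- z1); split; first by exists z1.
  by exists (- w1); split; [exists w1|rewrite !lerN2 wz1].
have NA z : A z -> (-%R @` A) (- z) by exists z.
have NG z : G z -> (-%R @` G) (- z) by exists z.
exists (- x), (- w0); split.
- move=> z Az [w [Gw /andP[sw wz]]]; rewrite lerNl; apply: h1; first exact: NA.
  by exists (- w); split; [exact: NG|rewrite !lerN2 wz].
- by case: h2 h3 h3' => w Gw <- h3 h3'; rewrite opprK; split => //; lra.
- by move=> z Az wz; rewrite lerNl; apply: h4; [exact: NA|rewrite lerNl].
- by move=> w Gw; rewrite -normrN opprD !opprK; have := h5 _ (NG _ Gw); rewrite opprK.
- move=> d /h6[_ [[z Az <-] zx dz]]; exists z; split => //; lra.
Qed.

(** All the masses involved are finite, so real numbers are preferred to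
    extended ones. *)
Definition mass (R : realType) (D : R) (h : R -> R) (A : set R) : R :=
  fine (density_measure D h A).

Section mass.
Context {R : realType}.
Variables (D : R) (h : R -> R).
Hypothesis ch : {within `[0, D], continuous h}.
Hypothesis h0 : forall x : R, 0 <= x <= D -> 0 <= h x.
Notation mu := (@lebesgue_measure R).
Notation m := (mass D h).

Let ih : mu.-integrable `[0, D] (EFin \o h) := continuous_itv_integrable ch.

Let ihS (A : set R) : measurable A -> mu.-integrable (A `&` `[0, D]) (EFin \o h).
Proof. by move=> mA; apply: integrableS ih => //; exact: measurableI. Qed.

Lemma density_measureE (A : set R) : measurable A -> density_measure D h A = (m A)%:E.
Proof.
move=> mA; rewrite /m fineK//; apply: integrable_fin_num; last exact: ihS.
exact: measurableI.
Qed.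

Lemma mass_ge0 (A : set R) : 0 <= m A.
Proof. by apply: Rintegral_ge0 => x [_ /=]; rewrite in_itv/=; exact: h0. Qed.

Lemma massU (A B : set R) : measurable A -> measurable B -> A `&` B = set0 ->
  m (A `|` B) = m A + m B.
Proof.
move=> mA mB AB; rewrite /mass /density_measure setIUl.
rewrite -/(Rintegral _ _ _) Rintegral_setU//.
- exact: measurableI.
- exact: measurableI.
- by rewrite -setIUl; apply: ihS; exact: measurableU.
- by apply/disj_setPS => x [[Ax _] [Bx _]]; rewrite -AB.
Qed.

Lemma mass_setD (A B : set R) : measurable A -> measurable B -> A `<=` B ->
  m (B `\` A) = m B - m A.
Proof.
move=> mA mB AB; rewrite -{2}(setDUK AB) massU//; last by rewrite setDIK.
  by rewrite addrAC subrr add0r.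
exact: measurableD.
Qed.

Lemma le_mass (A B : set R) : measurable A -> measurable B -> A `<=` B -> m A <= m B.
Proof. by move=> mA mB AB; rewrite -subr_ge0 -mass_setD// mass_ge0. Qed.

Lemma mass_itv (i : interval R) : [set` i] `<=` `[0, D] ->
  m [set` i] = \int[mu]_(x in [set` i]) h x.
Proof. by move=> iD; rewrite /mass /density_measure (setIidl iD). Qed.

Lemma mass_gap_ge (x e c l : R) : 0 < e -> 0 <= x -> x + e <= D -> 0 < l ->
  (forall y, x < y < x + e -> c <= l * h y) -> e * c <= l * m `]x, x + e[.
Proof.
move=> e0 x0 xD l0 hc; rewrite mass_itv; last first.
  by move=> y /=; rewrite !in_itv/= => /andP[xy ye]; lra.
have -> : e * c = l * \int[mu]_(y in `]x, x + e[) (c / l).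
  have mE : fine (mu `]x, x + e[%classic) = e.
    rewrite lebesgue_measure_itv/= lte_fin ltrDl e0.
    by rewrite -EFinB/= [x + e]addrC addrK.
  rewrite Rintegral_cst//; transitivity (l * (c / l * e)); last by rewrite -{1}mE.
  by field; rewrite gt_eqF.
rewrite ler_pM2l//; apply: le_Rintegral => //.
- have : mu.-integrable `[x, x + e] (EFin \o cst (c / l)).
    by apply: continuous_itv_integrable; apply: continuous_subspaceT => y; exact: cvg_cst.
  by apply: integrableS => //; exact: subset_itv_oo_cc.
- apply: integrableS ih => //.
  by move=> y /=; rewrite !in_itv/= => /andP[xy ye]; lra.
- by move=> y /=; rewrite in_itv/= => /hc; rewrite ler_pdivrMr// mulrC.
Qed.

End mass.

(** * The gaps around a set carry mass *)

Section gap_mass.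
Context {R : realType}.
Variables (D : R) (h : R -> R).
Hypothesis ch : {within `[0, D], continuous h}.
Hypothesis h0 : forall x : R, 0 <= x <= D -> 0 <= h x.
Notation mu := (@lebesgue_measure R).
Notation m := (mass D h).

(** All the points of A that see G on their right before t lie behind a single
    gap ]x1, x1 + e[, and those that see G on their left after s lie behind a
    single gap ]x2 - e, x2[. On the first one, l * h is at least the mass of
    [0, x1], on the second one, at least the mass of [x2, D]; and
    these two segments cover A. The two gaps are disjoint: if x1 < x2, then
    the point w1 of G behind the first gap lies before x2, because no point
    of A lies between x1 and w1, and it is at distance at least e from x2. *)
Lemma gap_mass (A G : set R) (e l t s : R) :
  measurable A -> measurable G -> A `<=` `[0, D] -> G `<=` `[0, D] ->
  0 < e -> 0 < l -> apart A G e ->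
  (forall z, A z -> exists w, G w /\ (z <= w <= t \/ s <= w <= z)) ->
  (forall y, 0 <= y <= D -> y <= t -> \int[mu]_(x in `[0, y]) h x <= l * h y) ->
  (forall y, 0 <= y <= D -> s <= y -> \int[mu]_(x in `[y, D]) h x <= l * h y) ->
  e * m A <= l * m (`[0, D] `\` (A `|` G)).
Proof.
move=> mA mG AD GD e0 l0 sep cov hl hr.
pose F := `[0, D]%classic `\` (A `|` G); rewrite -/F.
have mF : measurable F by apply: measurableD => //; exact: measurableU.
pose A1 z := A z /\ exists w, G w /\ z <= w <= t.
pose A2 z := A z /\ exists w, G w /\ s <= w <= z.
have A12 z : A z -> A1 z \/ A2 z.
  by move=> Az; have [w [Gw [?|?]]] := cov z Az; [left|right]; split => //; exists w.
have A0 z : A z -> 0 <= z <= D by move=> /AD /=; rewrite in_itv.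
have G0 z : G z -> 0 <= z <= D by move=> /GD /=; rewrite in_itv.
have rside : (exists z, A1 z) -> exists x w0 : R,
    [/\ forall z, A1 z -> z <= x, G w0 /\ x + e <= w0,
        forall z, A z -> z <= w0 -> z <= x,
        `]x, x + e[ `<=` F /\ x <= D & e * m `[0, x] <= l * m `]x, x + e[].
  move=> /(gap_right e0 sep)[x [w0 [h1 [Gw0 /andP[xw0 w0t]] h3 h4 h5]]].
  have x0 : 0 <= x.
    by have [z [/A0 z0 zx _]] := h5 e e0; lra.
  have w0D := G0 _ Gw0.
  exists x, w0; split => //.
  - by move=> z [Az ?]; exact: h1.
  - split; last lra.
    move=> y /=; rewrite in_itv/= => /andP[xy yx]; split; first by rewrite /= in_itv/=; lra.
    move=> [Ay|Gy]; first by have := h3 y Ay; lra.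
    by have := h4 y Gy; rewrite ltr0_norm; [lra|lra].
  - apply: mass_gap_ge => //; first lra.
    move=> y /andP[xy yx]; rewrite mass_itv; last first.
      by move=> u /=; rewrite !in_itv/=; lra.
    apply: le_trans (hl y _ _); [|lra|lra].
    have cy : {within `[0, y], continuous h} by apply: within_itvS ch => //; lra.
    rewrite (@Rintegral_itv_split _ h 0 y x)//; [|lra..].
    rewrite lerDl; apply: Rintegral_itv_ge0 => u ?; apply: h0; lra.
have lside : (exists z, A2 z) -> exists x w0 : R,
    [/\ forall z, A2 z -> x <= z, G w0 /\ w0 <= x - e,
        forall d, 0 < d -> exists z, [/\ A z, x <= z & z < x + d],
        `]x - e, x[ `<=` F /\ (0 <= x /\ forall w, G w -> e <= `|x - w|)
        & e * m `[x, D] <= l * m `]x - e, x[].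
  move=> /(gap_left e0 sep)[x [w0 [h1 [Gw0 /andP[sw0 xw0]] h3 h4 h5]]].
  have x0 : x <= D.
    by have [z [/A0 z0 zx _]] := h5 e e0; lra.
  have w0D := G0 _ Gw0.
  exists x, w0; split => //.
  - by move=> z [Az ?]; exact: h1.
  - split; last by split => //; lra.
    move=> y /=; rewrite in_itv/= => /andP[xy yx]; split; first by rewrite /= in_itv/=; lra.
    move=> [Ay|Gy]; first by have := h3 y Ay; lra.
    by have := h4 y Gy; rewrite gtr0_norm; [lra|lra].
  - have xe : x - e + e = x by rewrite subrK.
    rewrite -[in X in _ <= _ * m X]xe.
    have := @mass_gap_ge R D h ch (x - e) e (m `[x, D]) l e0; rewrite !xe; apply => //; first lra.
    move=> y /andP[xy yx]; rewrite mass_itv; last first.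
      by move=> u /=; rewrite !in_itv/=; lra.
    apply: le_trans (hr y _ _); [|lra|lra].
    have cy : {within `[y, D], continuous h} by apply: within_itvS ch => //; lra.
    rewrite (@Rintegral_itv_split _ h y D x)//; [|lra..].
    rewrite lerDr; apply: Rintegral_itv_ge0 => u ?; apply: h0; lra.
have [E1|N1] := pselect (exists z, A1 z); have [E2|N2] := pselect (exists z, A2 z).
- have [x1 [w1 [a1 [Gw1 xw1] b1 [I1 x1D] c1]]] := rside E1.
  have [x2 [w2 [a2 [Gw2 xw2] b2 [I2 [x20 d2]] c2]]] := lside E2.
  have dis : `]x1, x1 + e[ `&` `]x2 - e, x2[ = set0.
    rewrite -subset0 => y [/=]; rewrite !in_itv/= => /andP[y1 y2] /andP[y3 y4].
    have [w1x2|x2w1] := leP w1 x2.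
      by have := d2 _ Gw1; rewrite ger0_norm; [lra|lra].
    have [z [Az x2z zw1]] := b2 (w1 - x2) ltac:(by rewrite subr_gt0).
    have := b1 z Az; lra.
  have : m (`]x1, x1 + e[ `|` `]x2 - e, x2[) <= m F.
    by apply: le_mass => //; [exact: measurableU|move=> y [/I1|/I2]].
  rewrite massU// => mI.
  have mAle : m A <= m `[0, x1] + m `[x2, D].
    have AU : A `<=` `[0, x1] `|` (`[x2, D] `\` `[0, x1]).
      move=> z Az; have [zx1|x1z] := leP z x1.
        by left; rewrite /= in_itv/= zx1 andbT; have := A0 _ Az; lra.
      right; split; rewrite /= in_itv/=; last by apply/negP; lra.
      have [/a1|/a2 x2z] := A12 _ Az; first lra.
      by rewrite x2z/=; have := A0 _ Az; lra.
    have mD' : measurable (`[x2, D]%classic `\` `[0, x1]%classic) by exact: measurableD.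
    apply: le_trans (le_mass ch h0 mA _ AU) _; first exact: measurableU.
    rewrite massU//; last by rewrite setDIK.
    by rewrite lerD2l; apply: le_mass => //; move=> ? [].
  apply: (@le_trans _ _ (l * (m `]x1, x1 + e[ + m `]x2 - e, x2[))).
    rewrite mulrDr (le_trans _ (lerD c1 c2))//.
    by rewrite -mulrDr ler_pM2l.
  by rewrite ler_pM2l.
- have [x1 [w1 [a1 _ b1 [I1 x1D] c1]]] := rside E1.
  apply: (le_trans _ (le_trans c1 _)).
    rewrite ler_pM2l//; apply: le_mass => // z Az; rewrite /= in_itv/=.
    have [/a1 ->|A2z] := A12 _ Az; first by have := A0 _ Az; lra.
    by case: N2; exists z.
  by rewrite ler_pM2l//; exact: le_mass.
- have [x2 [w2 [a2 _ b2 [I2 _] c2]]] := lside E2.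
  apply: (le_trans _ (le_trans c2 _)).
    rewrite ler_pM2l//; apply: le_mass => // z Az; rewrite /= in_itv/=.
    have [A1z|/a2 ->] := A12 _ Az; last by have := A0 _ Az; lra.
    by case: N1; exists z.
  by rewrite ler_pM2l//; exact: le_mass.
- rewrite (_ : A = set0).
    by rewrite /mass /density_measure set0I integral_set0 mulr0 mulr_ge0 ?(ltW l0)// mass_ge0.
  rewrite -subset0 => z /A12[A1z|A2z]; first by case: N1; exists z.
  by case: N2; exists z.
Qed.

(** If z in A and w0 in G both fail, and z < w0 say, then A has no point
    between t and w0, and G has none between z and t + k. The last point x of A
    before w0 is then before t, so that x + e, which is at distance at
    least e from A, is a point of G between z and t + k: a contradiction. This
    is where the margin k >= e is used. *)
Lemma covering_dichotomy (A : set R) (e k t s : R) :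
  A `<=` `[0, D] -> 0 < e -> e <= k ->
  let G := [set w | `[0, D]%classic w /\ forall z, A z -> e <= `|z - w|] in
  (forall z, A z -> exists w, G w /\ (z <= w <= t + k \/ s <= w <= z)) \/
  (forall w, G w -> exists z, A z /\ (w <= z <= s + k \/ t <= z <= w)).
Proof.
move=> AD e0 ek G.
have [|nP] := pselect (forall z, A z -> exists w, G w /\ (z <= w <= t + k \/ s <= w <= z)).
  by left.
right=> w0 Gw0; apply: contrapT => nQ; apply: nP => z Az; apply: contrapT => nP.
have A0 y : A y -> 0 <= y <= D by move=> /AD /=; rewrite in_itv.
have [w0D sep0] := Gw0; move: w0D; rewrite /= in_itv/= => w0D.
have nPw w : G w -> ~ (z <= w <= t + k) /\ ~ (s <= w <= z).
  by move=> Gw; split => hx; apply: nP; exists w; split => //; [left|right].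
have nQz y : A y -> ~ (w0 <= y <= s + k) /\ ~ (t <= y <= w0).
  by move=> Ay; split => hx; apply: nQ; exists y; split => //; [left|right].
have [z1 z2] := nPw _ Gw0; have [w1 w2] := nQz _ Az.
have dist y : A y -> y + e <= w0 \/ w0 + e <= y.
  move=> Ay; have := sep0 y Ay; have [yw|yw] := leP y w0.
    by rewrite ler0_norm; [left; lra|lra].
  by rewrite gtr0_norm; [right; lra|lra].
have [zw|wz] := dist _ Az.
- have w0t : t + k < w0.
    by rewrite ltNge; apply/negP => hx; apply: z1; lra.
  pose S := [set y | A y /\ y <= w0].
  have Sz : S z by split => //; lra.
  have St y : S y -> y <= t.
    move=> [Ay yw]; have [_] := nQz _ Ay => hx.
    by rewrite leNgt; apply/negP => ty; apply: hx; rewrite (ltW ty).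
  have supS : has_sup S by split; [exists z|exists t].
  have zx : z <= sup S by apply: ub_le_sup => //; case: supS.
  have xt : sup S <= t by apply: sup_le_ub => //; exists z.
  apply: (nPw (sup S + e) _).1; last lra.
  split; first by rewrite /= in_itv/=; have := A0 _ Az; lra.
  move=> y Ay; have [yw|wy] := dist _ Ay.
    have : y <= sup S by apply: ub_le_sup; [case: supS|split => //; lra].
    by move=> ?; rewrite ler0_norm; lra.
  by rewrite ger0_norm; lra.
- have w0s : w0 < s.
    by rewrite ltNge; apply/negP => hx; apply: z2; lra.
  pose S := [set y | A y /\ w0 <= y].
  have Sz : S z by split => //; lra.
  have St y : S y -> s + k <= y.
    move=> [Ay yw]; have [] := nQz _ Ay => hx _.
    by rewrite leNgt; apply/negP => ty; apply: hx; rewrite yw ltW.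
  have infS : has_inf S by split; [exists z|exists (s + k)].
  have zx : inf S <= z by apply: ge_inf => //; case: infS.
  have xt : s + k <= inf S by apply: lb_le_inf => //; exists z.
  have xw : w0 + e <= inf S.
    apply: lb_le_inf; first by exists z.
    by move=> y [Ay wy]; have [|//] := dist _ Ay; lra.
  apply: (nPw (inf S - e) _).2; last lra.
  split; first by rewrite /= in_itv/=; have := A0 _ Az; lra.
  move=> y Ay; have [yw|wy] := dist _ Ay.
    by rewrite ler0_norm; lra.
  have : inf S <= y by apply: ge_inf; [case: infS|split => //; lra].
  by move=> ?; rewrite ger0_norm; lra.
Qed.

End gap_mass.

(** * Enlargements and outer Minkowski content *)

Section outer_minkowski.
Context {R : realType}.
Implicit Types (A : set R) (e : R).

Lemma enlargementE A e : enlargement A e = \bigcup_(z in A) ball z e.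
Proof.
apply/seteqP; split => x /=.
  move=> /ereal_inf_lt[_ [z Az <-] xz]; exists z => //.
  exact/ball_sym/(edist_lt_ball xz).
move=> [z Az]; rewrite /ball/= => zx.
have e0 : 0 < e by exact: le_lt_trans zx.
apply: (@le_lt_trans _ _ (edist (x, z))).
  by apply: ereal_inf_lbound; exists z.
apply: (@le_lt_trans _ _ (((`|z - x| + e) / 2)%:E)); last by rewrite lte_fin; lra.
apply: edist_fin; first by rewrite divr_gt0// ltr_wpDl.
by rewrite /ball/= distrC; lra.
Qed.

Lemma measurable_enlargement A e : measurable (enlargement A e).
Proof.
apply: measurable_realfun.open_measurable; rewrite enlargementE; apply: bigcup_open => z _.
exact: ball_open.
Qed.

Lemma outer_minkowski_ge (mu : set R -> \bar R) A (k : R) (c : \bar R) : 0 < k ->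
  (forall e, 0 < e <= k -> (c <= (mu (enlargement A e) - mu A) * (e^-1)%:E)%E) ->
  (c <= outer_minkowski mu A)%E.
Proof.
move=> k0 hk; rewrite /outer_minkowski limf_einfE.
apply: le_ereal_sup_tmp.
exists (ereal_inf ((fun e : R => ((mu (enlargement A e) - mu A) * (e^-1)%:E)%E)
           @` [set e : R | 0 < e <= k])).
  exists [set e : R | 0 < e <= k] => //=.
  near=> e; apply/andP; split=> //; near: e.
  exact: nbhs_right_le.
by apply: le_ereal_inf_tmp => _ [e ek <-]; exact: hk.
Unshelve. all: by end_near. Qed.

Lemma outer_minkowski_le (mu : set R -> \bar R) A (k : R) (c : \bar R) : 0 < k ->
  (forall e, 0 < e < k -> ((mu (enlargement A e) - mu A) * (e^-1)%:E <= c)%E) ->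
  (outer_minkowski mu A <= c)%E.
Proof.
move=> k0 hk; rewrite /outer_minkowski limf_einfE.
apply: ge_ereal_sup => _ [V V0 <-].
have : \forall e \near 0^'+, V e /\ 0 < e < k.
  near=> e; split; first by near: e.
  by apply/andP; split=> //; near: e; exact: nbhs_right_lt.
move=> /filter_ex[e [Ve ek]].
by apply: le_trans (hk _ ek); apply: ereal_inf_lbound; exists e.
Unshelve. all: by end_near. Qed.

End outer_minkowski.

Section perimeter.
Context {R : realType}.
Variables (D : R) (h : R -> R).
Hypothesis ch : {within `[0, D], continuous h}.
Hypothesis h0 : forall x : R, 0 <= x <= D -> 0 <= h x.
Hypothesis h1 : mass D h `[0, D] = 1.
Notation mu := (@lebesgue_measure R).
Notation m := (mass D h).

Lemma quotient_massE (A : set R) (e : R) : measurable A ->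
  ((density_measure D h (enlargement A e) - density_measure D h A) * (e^-1)%:E)%E =
  ((m (enlargement A e) - m A) / e)%:E.
Proof.
by move=> mA; rewrite !density_measureE//; exact: measurable_enlargement.
Qed.

(** In the second case of the dichotomy it is the mass of the complement G of
    the enlargement that is estimated. Since this is 1 - v - d, where d is the
    increase of the mass, the conclusion e * (1 - v - d) <= r * d has to be
    solved for d, which turns r into r + e <= r + k. *)
Lemma mass_enlargement_ge (A : set R) (v l r t s k e c : R) :
  measurable A -> A `<=` `[0, D] -> m A = v -> 0 < e <= k ->
  0 < l -> 0 < r -> 0 <= c ->
  (forall y, 0 <= y <= D -> y <= t + k -> \int[mu]_(x in `[0, y]) h x <= l * h y) ->
  (forall y, 0 <= y <= D -> t <= y -> \int[mu]_(x in `[y, D]) h x <= r * h y) ->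
  (forall y, 0 <= y <= D -> y <= s + k -> \int[mu]_(x in `[0, y]) h x <= r * h y) ->
  (forall y, 0 <= y <= D -> s <= y -> \int[mu]_(x in `[y, D]) h x <= l * h y) ->
  c * l <= v -> c * (r + k) <= 1 - v ->
  e * c <= m (enlargement A e) - m A.
Proof.
move=> mA AD mAv /andP[e0 ek] l0 r0 c0 lt rt ls rs cl cr.
pose G := [set w | `[0, D]%classic w /\ forall z, A z -> e <= `|z - w|].
have EG : enlargement A e `&` `[0, D]%classic = `[0, D]%classic `\` G.
  apply/seteqP; split => x.
    rewrite enlargementE => -[[z Az zx] xD]; split => // -[_ /(_ z Az)].
    by rewrite leNgt => /negP; apply.
  move=> [xD nG]; split => //; rewrite enlargementE; apply: contrapT => nE; apply: nG.
  split => // z Az; rewrite leNgt; apply/negP => zx; apply: nE; exists z => //.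
have mG : measurable G.
  have -> : G = `[0, D]%classic `\` (enlargement A e `&` `[0, D]%classic).
    by rewrite EG setDD; apply/seteqP; split => [x []//|x [_ []]].
  by apply: measurableD => //; apply: measurableI => //; exact: measurable_enlargement.
have GD : G `<=` `[0, D] by move=> x [].
have AG : A `&` G = set0.
  rewrite -subset0 => x [Ax [_ /(_ x Ax)]]; rewrite subrr normr0; lra.
have mE : m (enlargement A e) = 1 - m G.
  have -> : m (enlargement A e) = m (`[0, D] `\` G).
    rewrite /mass /density_measure EG; congr (fine (integral _ _ _)).
    by rewrite setIC setIDA setIid.
  by rewrite mass_setD// h1.
have mF : m (`[0, D] `\` (A `|` G)) = m (enlargement A e) - m A.
  have mAG : measurable (A `|` G) by exact: measurableU.
  rewrite mass_setD//; last by move=> x [/AD|/GD].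
  by rewrite massU// h1 mE; lra.
have d0 : 0 <= m (enlargement A e) - m A by rewrite -mF mass_ge0.
have [|] := @covering_dichotomy _ D A e k t s AD e0 ek; rewrite -/G => cov.
  have := gap_mass ch h0 mA mG AD GD e0 l0 _ cov lt rs.
  rewrite mF => /(_ ltac:(by move=> z w Az [_]; exact)) H.
  rewrite -(ler_pM2l l0) (le_trans _ H)// mAv mulrCA ler_pM2l// mulrC//.
have := gap_mass ch h0 mG mA GD AD e0 r0 _ cov ls rt.
rewrite [G `|` A]setUC mF => /(_ ltac:(by move=> z w [_ /(_ w)] + Aw; rewrite distrC; exact)).
have -> : m G = 1 - v - (m (enlargement A e) - m A) by rewrite mE mAv; lra.
move: (m _ - m _) d0 => d d0 H.
have rk : 0 < r + k by lra.
rewrite -(ler_pM2l rk).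
have : e * (c * (r + k)) <= e * (1 - v) by rewrite ler_pM2l.
have : e * d <= k * d by rewrite ler_wpM2r.
lra.
Qed.

(** Up to the part outside [0, D], the enlargement of [0, a] is contained in
    [0, a + e]. *)
Lemma outer_minkowski_initial_le (a k c : R) : 0 < a -> a + k <= D -> 0 < k ->
  (forall y, a <= y <= a + k -> h y <= c) ->
  (outer_minkowski (density_measure D h) `[0%R, a]%classic <= c%:E)%E.
Proof.
move=> a0 akD k0 hc; apply: (@outer_minkowski_le _ _ _ k) => // e /andP[e0 ek].
rewrite quotient_massE// lee_fin ler_pdivrMr// lerBlDl.
have sub : enlargement `[0, a]%classic e `&` `[0, D] `<=` `[0, a + e].
  move=> x [] /=; rewrite enlargementE !in_itv/= => -[z /=].
  rewrite in_itv/= => za; rewrite /ball/= => zx /andP[-> _]/=.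
  by move: zx; rewrite ltr_norml => /andP[]; lra.
have -> : m (enlargement `[0, a]%classic e) = m (enlargement `[0, a]%classic e `&` `[0, D]).
  by rewrite /mass /density_measure -setIA setIid.
apply: (le_trans (le_mass ch h0 _ _ sub)) => //.
  by apply: measurableI => //; exact: measurable_enlargement.
rewrite !mass_itv; last 2 first.
- by move=> x /=; rewrite !in_itv/=; lra.
- by move=> x /=; rewrite !in_itv/=; lra.
rewrite (@Rintegral_itv_split _ h 0 (a + e) a); [|lra|lra|]; last first.
  by apply: within_itvS ch => //; lra.
rewrite lerD2l; apply: (@le_trans _ _ (\int[mu]_(x in `[a, (a + e)]) c)).
  apply: le_Rintegral_itv => [| |x xa].
  - by apply: within_itvS ch => //; lra.
  - by apply: continuous_subspaceT => x; exact: cvg_cst.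
  - by apply: hc; lra.
by rewrite Rintegral_itv_cst; lra.
Qed.

End perimeter.

(** * The weight given by the generalised sine *)

Section sine.
Context {R : realType}.
Implicit Types (k x a b c : R).

Lemma sin_ptolemy a b c :
  sin (a + b) * sin (b + c) = sin a * sin c + sin b * sin (a + b + c).
Proof.
rewrite (sinD (a + b) c) !sinD cosD; apply/eqP; rewrite -subr_eq0.
set u := (X in X == 0).
have -> : u = sin a * sin c * (cos b ^+ 2 + sin b ^+ 2 - 1) by rewrite /u; ring.
by rewrite cos2Dsin2 subrr mulr0.
Qed.

Lemma sinh_ptolemy a b c :
  sinh (a + b) * sinh (b + c) = sinh a * sinh c + sinh b * sinh (a + b + c).
Proof.
rewrite /sinh !opprD !expRD !expRN; field.
by rewrite !gt_eqF ?expR_gt0.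
Qed.

Lemma s_ptolemy k a b c :
  s_ k (a + b) * s_ k (b + c) = s_ k a * s_ k c + s_ k b * s_ k (a + b + c).
Proof.
rewrite /s_; case: ifPn => [k0|k0].
  have := sin_ptolemy (Num.sqrt k * a) (Num.sqrt k * b) (Num.sqrt k * c).
  rewrite -!mulrDr => e; rewrite mulrACA e; ring.
case: ifPn => [_|kN0]; first ring.
have := sinh_ptolemy (Num.sqrt (- k) * a) (Num.sqrt (- k) * b) (Num.sqrt (- k) * c).
rewrite -!mulrDr => e; rewrite mulrACA e; ring.
Qed.

Lemma s_continuous k : continuous (s_ k).
Proof.
move=> x.
have lin (r : R) : continuous (fun y => r * y).
  by move=> y; apply: cvgM; [exact: cvg_cst|exact: cvg_id].
have ce (r : R) : {for x, continuous (fun y => expR (r * y))}.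
  by apply: continuous_comp; [exact: lin|exact: continuous_expR].
have [k0|/negbTE k0] := boolP (0 < k); rewrite /s_ k0.
  apply: cvgM; last exact: cvg_cst.
  by apply: (@continuous_comp _ _ _ ( *%R (Num.sqrt k)) sin); [exact: lin|exact: continuous_sin].
have [_|kN0] := eqVneq k 0; first exact: cvg_id.
apply: cvgM; last exact: cvg_cst.
rewrite /sinh; apply: cvgM; last exact: cvg_cst.
apply: cvgB; first exact: ce.
have := ce (- Num.sqrt (- k)).
rewrite (_ : (fun y => _) = (fun y => expR (- (Num.sqrt (- k) * y)))) //.
by apply/funext => y; rewrite mulNr.
Qed.

Lemma s_gt0 k x : 0 < x -> (0 < k -> Num.sqrt k * x < pi) -> 0 < s_ k x.
Proof.
move=> x0 kx; rewrite /s_; case: ifPn => [k0|k0].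
  by rewrite divr_gt0 ?sqrtr_gt0// sin_gt0_pi// mulr_gt0 ?sqrtr_gt0// kx.
case: ifPn => // kN0.
have k0' : 0 < Num.sqrt (- k).
  by rewrite sqrtr_gt0 oppr_gt0 lt_neqAle kN0 leNgt.
rewrite divr_gt0// /sinh divr_gt0// subr_gt0 ltr_expR.
by rewrite gtrN// mulr_gt0.
Qed.

Lemma s_ge0 k x : 0 <= x -> (0 < k -> Num.sqrt k * x <= pi) -> 0 <= s_ k x.
Proof.
move=> x0 kx; have := x0; rewrite le_eqVlt => /predU1P[<-|{}x0].
  by rewrite /s_ mulr0 sin0 mul0r /sinh mulr0 oppr0 subrr !mul0r !if_same.
have [k0|k0] := boolP (0 < k); last by rewrite ltW// s_gt0//; move: k0 => /negP.
have [kxpi|kxpi] := ltP (Num.sqrt k * x) pi; first by rewrite ltW// s_gt0.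
rewrite /s_ k0 (_ : Num.sqrt k * x = pi) ?sinpi ?mul0r//.
by apply: le_anti; rewrite kx.
Qed.

(** The absolute value is there because the power of a negative number is 1 by
    convention, so that the power itself is discontinuous at 0. *)
Lemma powR_norm_continuous (n : R) : 0 < n -> continuous (fun y : R => `|y| `^ n).
Proof.
move=> n0 y; have [->|yN0] := eqVneq y 0.
  apply/cvgrPdist_lt => e e0; rewrite normr0 powR0 ?gt_eqF//.
  near=> z; rewrite sub0r normrN ger0_norm ?powR_ge0//.
  have -> : e = (e `^ n^-1) `^ n by rewrite -powRrM mulVf ?gt_eqF// powRr1// ltW.
  rewrite gt0_ltr_powR// ?nnegrE// ?powR_ge0//.
  near: z; have := @nbhs0_lt _ R (e `^ n^-1); apply; exact: powR_gt0.
apply: (@continuous_comp _ _ _ (fun z : R => `|z|) (fun z => z `^ n)).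
  exact: norm_continuous.
apply: differentiable_continuous; apply/derivable1_diffP.
by apply: derivable_powR; rewrite in_itv/= andbT normr_gt0.
Unshelve. all: by end_near. Qed.

Lemma powR_norm_mul_le (n x y z u : R) : 0 <= n ->
  0 <= x -> 0 <= y -> 0 <= z -> 0 <= u -> x * y <= z * u ->
  `|x| `^ n * `|y| `^ n <= `|z| `^ n * `|u| `^ n.
Proof.
move=> n0 x0 y0 z0 u0 xyzu; rewrite !ger0_norm// -(powRM _ x0 y0) -(powRM _ z0 u0).
by apply: ge0_ler_powR => //; rewrite nnegrE mulr_ge0.
Qed.

End sine.

(** The absolute value only matters outside [0, D]; it makes the weight
    continuous on the whole line. *)
Definition s_weight (R : realType) (K N x : R) : R := `|s_ (K / (N - 1)) x| `^ (N - 1).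

Section s_weight.
Context {R : realType}.
Variables (K N D : R).
Hypothesis hN : 1 < N.
Hypothesis hKD : 0 < K -> D <= pi * Num.sqrt ((N - 1) / K).

Let n0 : 0 < N - 1. Proof. by rewrite subr_gt0. Qed.
Notation k := (K / (N - 1)).

(** This is the hypothesis on D, in the form sqrt kappa * D <= pi. *)
Lemma sqrt_curvature_le x : x <= D -> 0 < k -> Num.sqrt k * x <= pi.
Proof.
move=> xD; rewrite pmulr_lgt0 ?invr_gt0// => K0.
have k0 : 0 < k by rewrite divr_gt0.
apply: le_trans (_ : Num.sqrt k * (pi * Num.sqrt ((N - 1) / K)) <= _).
  by rewrite ler_pM2l ?sqrtr_gt0// (le_trans xD)// hKD.
have kK : k * ((N - 1) / K) = 1 by field; rewrite !gt_eqF.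
by rewrite mulrCA -sqrtrM ?(ltW k0)// kK sqrtr1 mulr1.
Qed.

Lemma s_ge0_in x : 0 <= x <= D -> 0 <= s_ k x.
Proof. by move=> /andP[x0 xD]; apply: s_ge0 => // k0; exact: sqrt_curvature_le. Qed.

Lemma s_gt0_in x : 0 < x < D -> 0 < s_ k x.
Proof.
move=> /andP[x0 xD]; apply: s_gt0 => // k0.
apply: lt_le_trans (sqrt_curvature_le (lexx _) k0).
by rewrite ltr_pM2l// sqrtr_gt0.
Qed.

Lemma s_weightE x : 0 <= x <= D -> s_weight K N x = s_ k x `^ (N - 1).
Proof. by move=> xD; rewrite /s_weight ger0_norm// s_ge0_in. Qed.

Lemma s_weight_mcp : mcp_weight D (s_weight K N).
Proof.
have sle (a b c : R) : 0 <= a -> 0 <= b -> 0 <= c -> a + b + c <= D ->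
    [/\ 0 <= s_ k a, 0 <= s_ k b, 0 <= s_ k c, 0 <= s_ k (a + b) &
        0 <= s_ k (b + c) /\ 0 <= s_ k (a + b + c)].
  by move=> a0 b0 c0 abcD; split; [..|split]; apply: s_ge0_in; lra.
split.
- move=> x; apply: (@continuous_comp _ _ _ (s_ k) (fun y => `|y| `^ (N - 1))).
    exact: s_continuous.
  exact: powR_norm_continuous.
- by move=> x; exact: powR_ge0.
- by move=> x xD; rewrite powR_gt0// normr_gt0 gt_eqF// s_gt0_in.
- move=> a b c a0 b0 c0 abcD; have [sa sb sc sab [sbc sabc]] := sle a b c a0 b0 c0 abcD.
  apply: powR_norm_mul_le => //; first exact: ltW.
  by rewrite (s_ptolemy k a b c) lerDl mulr_ge0.
- move=> a b c a0 b0 c0 abcD; have [sa sb sc sab [sbc sabc]] := sle a b c a0 b0 c0 abcD.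
  apply: powR_norm_mul_le => //; first exact: ltW.
  by rewrite (s_ptolemy k a b c) lerDr mulr_ge0.
Qed.

End s_weight.

(** * The extremal profile *)

Definition profile (R : realType) (w : R -> R) (D a x : R) : R :=
  (lmass w D a + rmass w D a)^-1 *
  (if x <= a then w (D - x) / w (D - a) else w x / w a).

Section profile.
Context {R : realType}.
Variables (D : R) (w : R -> R) (a : R).
Hypothesis hw : mcp_weight D w.
Hypothesis aD : 0 < a < D.
Notation mu := (@lebesgue_measure R).
Notation p := (profile w D a).
Notation L := (lmass w D a).
Notation M := (rmass w D a).

Let wa : 0 < w a. Proof. exact: (weight_gt0 hw). Qed.
Let wDa : 0 < w (D - a). Proof. by apply: (weight_gt0 hw); move: aD; lra. Qed.
Let LM0 : 0 < L + M.
Proof. by apply: addr_gt0; [exact: (lmass_gt0 hw aD)|exact: (rmass_gt0 hw aD)]. Qed.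

Lemma balance_fraction (v : R) :
  (L + M)^-1 * L = v <-> (1 - v) * L = v * M.
Proof.
have LMN : L + M != 0 by rewrite gt_eqF.
split => [<-|e]; first by field.
by apply: (mulfI LMN); rewrite mulrA divff// mul1r mulrDl ![_ * v]mulrC -e; ring.
Qed.

(** Each of the two pieces is the larger one on its side of a, by Ptolemy's
    inequality. As a maximum of two multiples of densities, the profile
    inherits continuity and the MCP inequality from them. *)
Lemma profile_maxE x : 0 <= x <= D ->
  p x = (L + M)^-1 * Num.max (w (D - x) * (w (D - a))^-1) (w x * (w a)^-1).
Proof.
move=> /andP[x0 xD]; rewrite /profile; congr (_ * _).
have /andP[a0 ltaD] := aD.
case: ifPn => [xa|]; last rewrite -ltNge => ax; apply/esym.
  apply: max_l; rewrite ler_pdivrMr// mulrAC ler_pdivlMr//.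
  have := @weight_outer _ _ _ hw x (a - x) (D - a).
  have -> : x + (a - x) = a by ring.
  have -> : a - x + (D - a) = D - x by ring.
  by rewrite [w (D - x) * _]mulrC; apply; lra.
apply: max_r; rewrite ler_pdivrMr// mulrAC ler_pdivlMr//.
have := @weight_outer _ _ _ hw a (x - a) (D - x).
have -> : a + (x - a) = x by ring.
have -> : x - a + (D - x) = D - a by ring.
by rewrite [w (D - x) * _]mulrC; apply; lra.
Qed.

Lemma profile_ge0 x : 0 <= p x.
Proof.
rewrite /profile mulr_ge0 ?invr_ge0 ?(ltW LM0)//.
by case: ifP => _; rewrite divr_ge0 ?(weight_ge0 hw).
Qed.

Lemma profile_continuous : {within `[0, D], continuous p}.
Proof.
apply: (@subspace_eq_continuous _ _ _ (fun x => (L + M)^-1 *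
  ((fun x => w (D - x) * (w (D - a))^-1) \max (fun x => w x * (w a)^-1)) x)).
  by move=> x /set_mem/=; rewrite in_itv/= => xD; rewrite /from_subspace profile_maxE.
apply: continuous_subspaceT => x; apply: cvgM; first exact: cvg_cst.
apply: continuous_max; first exact: (continuous_weightB hw).
exact: (continuous_weightM hw).
Qed.

(** The MCP inequality for the density w itself: Ptolemy's inequality for the
    points 0, x0, x and x1, the outer or the inner one according to the order
    of the last three. *)
Lemma weight_transport (x0 x1 x : R) : 0 <= x0 <= D -> 0 <= x1 <= D ->
  x0 <= x <= x1 \/ x1 <= x <= x0 ->
  w x0 * w `|x1 - x| <= w x * w `|x1 - x0|.
Proof.
move=> h0 h1 [xx|xx].
  rewrite !ger0_norm; [|lra|lra].
  have := @weight_outer _ _ _ hw x0 (x - x0) (x1 - x).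
  by rewrite subrKC [x - x0 + _]addrC subrKA; apply; lra.
rewrite !ler0_norm; [|lra|lra]; rewrite !opprB.
have := @weight_inner _ _ _ hw x1 (x - x1) (x0 - x).
have -> : x1 + (x - x1) = x by ring.
have -> : x - x1 + (x0 - x) = x0 - x1 by ring.
have -> : x + (x0 - x) = x0 by ring.
by rewrite mulrC; apply; lra.
Qed.

Lemma profile_transport (x0 x1 x : R) : 0 <= x0 <= D -> 0 <= x1 <= D ->
  x0 <= x <= x1 \/ x1 <= x <= x0 ->
  p x0 * w `|x1 - x| <= p x * w `|x1 - x0|.
Proof.
move=> h0 h1 hx.
have xD : 0 <= x <= D by case: hx; lra.
rewrite !profile_maxE// -!mulrA ler_wpM2l ?invr_ge0 ?(ltW LM0)//.
rewrite !maxr_pMl ?(weight_ge0 hw)//.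
rewrite ge_max !le_max; apply/andP; split; apply/orP; [left|right].
  rewrite mulrAC [leRHS]mulrAC ler_wpM2r ?invr_ge0 ?(weight_ge0 hw)//.
  have := @weight_transport (D - x0) (D - x1) (D - x).
  have -> (y z : R) : D - y - (D - z) = z - y by ring.
  have -> : D - x1 - (D - x0) = x0 - x1 by ring.
  rewrite (distrC x x1) (distrC x0 x1); apply; [lra|lra|].
  by case: hx => hx; [right|left]; lra.
rewrite mulrAC [leRHS]mulrAC ler_wpM2r ?invr_ge0 ?(weight_ge0 hw)//.
exact: weight_transport.
Qed.

Lemma Rintegral_profile_left :
  \int[mu]_(x in `[0, a]) p x = (L + M)^-1 * L.
Proof.
rewrite -Rintegral_itvZl; last first.
  by apply: continuous_subspaceT; exact: (continuous_weightB hw).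
by apply: eq_Rintegral_itv => x /andP[_ xa]; rewrite /profile xa.
Qed.

Lemma Rintegral_profile_right :
  \int[mu]_(x in `[a, D]) p x = (L + M)^-1 * M.
Proof.
rewrite -Rintegral_itvZl; last first.
  by apply: continuous_subspaceT; exact: (continuous_weightM hw).
apply: eq_Rintegral_itv => x /andP[ax _]; rewrite /profile; case: ifPn => // xa.
have -> : x = a by apply: le_anti; rewrite xa.
by rewrite !divff ?gt_eqF.
Qed.

Lemma Rintegral_profile : \int[mu]_(x in `[0, D]) p x = 1.
Proof.
have /andP[a0 ltaD] := aD.
rewrite (Rintegral_itv_split (ltW a0) (ltW ltaD) profile_continuous).
rewrite Rintegral_profile_left Rintegral_profile_right -mulrDr mulVf//.
by rewrite gt_eqF.
Qed.

Lemma profile_near (c : R) : (L + M)^-1 < c ->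
  exists2 k : R, 0 < k & a + k <= D /\ forall y, a <= y <= a + k -> p y <= c.
Proof.
move=> cLM; have /andP[a0 ltaD] := aD.
have [||d d0 hd] := @continuous_gt0_near R (fun y => c - (L + M)^-1 * (w y * (w a)^-1)) a.
- apply: cvgB; first exact: cvg_cst.
  apply: cvgM; first exact: cvg_cst.
  exact: (continuous_weightM hw).
- by rewrite divff ?gt_eqF// mulr1 subr_gt0.
have m0 : 0 < Num.min (d / 2) (D - a) by rewrite lt_min; lra.
have md : Num.min (d / 2) (D - a) <= d / 2 by rewrite ge_min lexx.
have mD : Num.min (d / 2) (D - a) <= D - a by rewrite ge_min lexx orbT.
exists (Num.min (d / 2) (D - a)) => //; split; first lra.
move=> y ya; rewrite /profile; case: ifPn => [ya'|_].
  have -> : y = a by lra.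
  by rewrite divff ?gt_eqF// mulr1 ltW.
by rewrite ltW// -subr_gt0 hd// ger0_norm; lra.
Qed.

(** If neither mass bound is strict at a, then h is proportional to the
    profile, with a factor determined by its total mass. *)
Lemma slack_or_rigid (h : R -> R) : mcp_comparison D w h ->
  {within `[0, D], continuous h} -> (forall x : R, 0 <= x <= D -> 0 <= h x) ->
  \int[mu]_(x in `[0, D]) h x = 1 ->
  has_slack D h L M \/ forall x, 0 <= x <= D -> h x = p x.
Proof.
move=> hh ch h0 h1; have /andP[a0 ltaD] := aD.
have := Rintegral_le_lmass hw hh ch aD.
rewrite le_eqVlt => /predU1P[il|]; last by left; exact: slack_left.
have := Rintegral_le_rmass hw hh ch aD.
rewrite le_eqVlt => /predU1P[ir|]; last by left; exact: slack_right.
right=> x xD; rewrite (comparison_rigid hw hh ch aD il ir xD) /profile; congr (_ * _).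
apply: (mulIf (x := L + M)); first by rewrite gt_eqF.
rewrite mulVf ?gt_eqF// mulrDr -il -ir -h1; apply/esym.
exact: (Rintegral_itv_split (ltW a0) (ltW ltaD) ch).
Qed.

End profile.

(** * MCP densities in terms of the weight *)

(** The coefficient sigma enters only through its power, as in the hypothesis
    below, in which the value w theta = 0 stands for theta = pi / sqrt kappa. *)
Section transport.
Context {R : realType}.
Variables (K N D : R) (w : R -> R).
Hypothesis hN : 1 < N.
Hypothesis hw : mcp_weight D w.
Hypothesis hsig : forall t theta : R, 0 <= t <= 1 -> 0 < theta <= D ->
  (sigma K (N - 1) t theta `^ (N - 1))%E =
  if w theta == 0 then +oo%E else (w (t * theta) / w theta)%:E.

(** Transport x towards the end points D and 0. Where sigma is infinite, the
    MCP inequality forces h to vanish at the starting point. *)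
Lemma MCP_comparison (h : R -> R) : MCP_density K N D h -> mcp_comparison D w h.
Proof.
move=> [_ _ h0 hmcp].
have key (x0 x1 x : R) : 0 <= x0 <= D -> 0 <= x1 <= D -> 0 <= x <= D ->
    x0 < x <= x1 \/ x1 <= x < x0 ->
    h x0 * w `|x1 - x| <= h x * w `|x1 - x0|.
  move=> x0D x1D xD hx.
  have xN : x1 - x0 != 0 by rewrite subr_eq0; apply/eqP => e; lra.
  pose t := (x - x0) / (x1 - x0).
  have tE : t * (x1 - x0) = x - x0 by rewrite divfK.
  have tE' : (1 - t) * (x1 - x0) = x1 - x by rewrite mulrBl tE; ring.
  have t01 : 0 <= t <= 1.
    have [x01|x10] := ltP x0 x1.
      by rewrite divr_ge0 ?ler_pdivrMr ?subr_gt0//; lra.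
    have x10' : x1 - x0 < 0 by lra.
    by rewrite /t -[_ / _]mulrNN -invrN divr_ge0 ?ler_pdivrMr; lra.
  have th : 0 < `|x1 - x0| <= D by rewrite normr_gt0 xN ler_norml; lra.
  have := hmcp x0 x1 t; rewrite !in_itv/= => /(_ x0D x1D t01).
  have -> : t * x1 + (1 - t) * x0 = x by rewrite -[RHS](subrK x0) -tE; ring.
  have t01' : 0 <= 1 - t <= 1 by lra.
  rewrite (hsig t01' th).
  have -> : (1 - t) * `|x1 - x0| = `|x1 - x|.
    rewrite -tE' normrM [`|1 - t|]ger0_norm//; lra.
  have hx0 : 0 <= h x0 by apply: h0; rewrite in_itv.
  have hhx : 0 <= h x by apply: h0; rewrite in_itv.
  case: ifPn => [/eqP w0|wN0].
    have [<-|hx0N] := eqVneq 0 (h x0).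
      by move=> _; rewrite mul0r w0 mulr0.
    have hpos : (0 < (h x0)%:E)%E by rewrite lte_fin lt_neqAle hx0N.
    by rewrite (gt0_mulye hpos) leye_eq.
  have w0 : 0 < w `|x1 - x0| by rewrite lt_neqAle eq_sym wN0 (weight_ge0 hw).
  by rewrite -EFinM lee_fin mulrAC ler_pdivrMr// [w _ * _]mulrC.
split=> x y x0 xy yD.
- have [->//|xyN] := eqVneq x y.
  have := @key x D y; rewrite !ger0_norm; [|lra|lra].
  have : x < y by rewrite lt_neqAle xyN.
  by move=> ? ; apply; [lra|lra|lra|left; lra].
- have [->//|xyN] := eqVneq x y.
  have := @key y 0 x; rewrite !sub0r !normrN !ger0_norm; [|lra|lra].
  have : x < y by rewrite lt_neqAle xyN.
  by move=> ? ; apply; [lra|lra|lra|right; lra].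
Qed.

(** Where sigma is infinite the inequality requires the profile to vanish at
    x0. This follows from the transport inequality towards the midpoint, in
    which the weight of the whole distance is 0. *)
Lemma profile_MCP (a : R) : 0 < a < D -> MCP_density K N D (profile w D a).
Proof.
move=> aD; have cp := profile_continuous hw aD.
split => //.
- by apply: measurable_realfun.subspace_continuous_measurable_fun.
- by move=> x _; exact: (profile_ge0 hw aD).
move=> x0 x1 t; rewrite !in_itv/= => x0D x1D t01.
have [e|xN] := eqVneq x0 x1.
  rewrite -e subrr normr0 /sigma eqxx poweR_EFin -EFinM lee_fin.
  have -> : t * x0 + (1 - t) * x0 = x0 by ring.
  rewrite -[leRHS]mul1r ler_wpM2r ?(profile_ge0 hw aD)//.
  apply: (@le_trans _ _ (1 `^ (N - 1))); last by rewrite powR1.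
  by apply: ge0_ler_powR; rewrite ?nnegrE ?subr_ge0 ?(ltW hN)//; lra.
have xN' : x1 - x0 != 0 by rewrite subr_eq0 eq_sym.
have th : 0 < `|x1 - x0| <= D by rewrite normr_gt0 xN' ler_norml; lra.
have btw (r : R) : 0 <= r <= 1 ->
    profile w D a x0 * w ((1 - r) * `|x1 - x0|) <=
    profile w D a (r * x1 + (1 - r) * x0) * w `|x1 - x0|.
  move=> r01; set x := r * x1 + (1 - r) * x0.
  have -> : (1 - r) * `|x1 - x0| = `|x1 - x|.
    have -> : x1 - x = (1 - r) * (x1 - x0) by rewrite /x; ring.
    by rewrite normrM [`|1 - r|]ger0_norm//; lra.
  apply: (profile_transport hw aD) => //.
  by rewrite /x; have [?|?] := leP x0 x1; [left|right]; apply/andP; split; nra.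
have t01' : 0 <= 1 - t <= 1 by lra.
rewrite (hsig t01' th).
case: ifPn => [/eqP w0|wN0].
  suff -> : profile w D a x0 = 0 by rewrite mule0 lee_fin (profile_ge0 hw aD).
  have := btw (1 / 2) ltac:(lra); rewrite w0 mulr0 => /= le0.
  have wh : 0 < w ((1 - 1 / 2) * `|x1 - x0|) by apply: (weight_gt0 hw); lra.
  apply: le_anti; rewrite (profile_ge0 hw aD) andbT.
  by rewrite -(pmulr_lle0 _ wh); exact: le0.
have w0 : 0 < w `|x1 - x0| by rewrite lt_neqAle eq_sym wN0 (weight_ge0 hw).
rewrite -EFinM lee_fin mulrAC ler_pdivrMr// [w _ * _]mulrC.
exact: btw.
Qed.

End transport.

Section translation.
Context {R : realType}.
Variables (K N D : R).
Hypothesis hN : 1 < N.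
Hypothesis hD : 0 < D.
Hypothesis hKD : 0 < K -> D <= pi * Num.sqrt ((N - 1) / K).
Notation mu := (@lebesgue_measure R).
Notation w := (s_weight K N).

Let n0 : 0 < N - 1. Proof. by rewrite subr_gt0. Qed.
Let hw : mcp_weight D w := s_weight_mcp hN hKD.

Lemma powR_ratio (n x y : R) : 0 <= x -> 0 < y -> (x / y) `^ n = x `^ n / y `^ n.
Proof.
move=> x0 y0; apply: (mulIf (x := y `^ n)); first by rewrite gt_eqF// powR_gt0.
rewrite -(powRM n (divr_ge0 x0 (ltW y0)) (ltW y0)) !divfK//.
  by rewrite gt_eqF// powR_gt0.
by rewrite gt_eqF.
Qed.

Lemma s_ratioE x y : 0 <= x <= D -> 0 < y < D ->
  (s_ (K / (N - 1)) x / s_ (K / (N - 1)) y) `^ (N - 1) = w x / w y.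
Proof.
move=> xD yD; rewrite powR_ratio.
- by rewrite (s_weightE hN hKD xD) (@s_weightE _ K N D hN hKD y)//; lra.
- exact: (s_ge0_in hN hKD).
- exact: (s_gt0_in hN hKD).
Qed.

Lemma f_sumE (a : R) : 0 < a < D -> f_ K N D a = (lmass w D a + rmass w D a)^-1.
Proof.
move=> aD; rewrite /f_; congr ((_ + _)^-1); apply: eq_Rintegral_itv => x xa.
  by apply: s_ratioE; lra.
by apply: s_ratioE; lra.
Qed.

Lemma h_profileE (a x : R) : 0 < a < D -> 0 <= x <= D -> h_ K N D a x = profile w D a x.
Proof.
move=> aD xD; rewrite /h_ f_sumE// /profile.
by case: ifP => _; congr (_ * _); apply: s_ratioE; lra.
Qed.

Lemma sigma_weight (t theta : R) : 0 <= t <= 1 -> 0 < theta <= D ->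
  (sigma K (N - 1) t theta `^ (N - 1))%E =
  if w theta == 0 then +oo%E else (w (t * theta) / w theta)%:E.
Proof.
move=> t01 /andP[th0 thD]; rewrite /sigma gt_eqF//.
have tth : 0 <= t * theta <= D.
  rewrite mulr_ge0 ?(ltW th0) ?(andP t01).1//= (le_trans _ thD)//.
  by rewrite ger_pMl// (andP t01).2.
have thD' : 0 <= theta <= D by rewrite ltW.
case: ifPn => [/andP[k0 pik]|npik].
  have -> : w theta = 0.
    rewrite (s_weightE hN hKD thD') /s_ k0.
    have -> : Num.sqrt (K / (N - 1)) * theta = pi.
      apply: le_anti; rewrite (sqrt_curvature_le hN hKD)//= mulrC -ler_pdivrMr//.
      by rewrite sqrtr_gt0.
    by rewrite sinpi mul0r powR0// gt_eqF.
  by rewrite eqxx poweRyr// gt_eqF.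
have s0 : 0 < s_ (K / (N - 1)) theta.
  apply: s_gt0 => // k0; move: npik; rewrite k0/= -ltNge ltr_pdivlMr ?sqrtr_gt0//.
  by rewrite mulrC.
have w0 : w theta != 0 by rewrite (s_weightE hN hKD thD') gt_eqF// powR_gt0.
rewrite (negbTE w0) poweR_EFin powR_ratio//; last exact: (s_ge0_in hN hKD).
by rewrite (s_weightE hN hKD thD') (s_weightE hN hKD tth).
Qed.

Lemma a_balance (v : R) : 0 < v < 1 -> 0 < a_ K N D v < D /\
  (1 - v) * lmass w D (a_ K N D v) = v * rmass w D (a_ K N D v).
Proof.
move=> v01.
have intE (a : R) : 0 < a < D ->
    \int[mu]_(x in `[0, a]) h_ K N D a x =
    (lmass w D a + rmass w D a)^-1 * lmass w D a.
  move=> aD; rewrite -(Rintegral_profile_left a hw).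
  by apply: eq_Rintegral_itv => x xa; apply: h_profileE => //; lra.
rewrite /a_; case: xgetP => [b _ /= [bD]|na].
  by rewrite (intE _ bD) => /(balance_fraction hw bD) e; split.
have [a aD /(balance_fraction hw aD) ea] := balance_exists hw hD v01.
by case: (na a); split; [exact: aD|rewrite (intE _ aD)].
Qed.

End translation.

(** * Rigidity *)

Section gap.
Context {R : realType}.
Variables (D : R) (w h : R -> R) (v a b : R).
Hypothesis hw : mcp_weight D w.
Hypothesis ch : {within `[0, D], continuous h}.
Hypothesis h0 : forall x : R, 0 <= x <= D -> 0 <= h x.
Hypothesis h1 : mass D h `[0, D] = 1.
Hypothesis v01 : 0 < v < 1.
Hypothesis aD : 0 < a < D.
Hypothesis bD : 0 < b < D.
Hypothesis ea : (1 - v) * lmass w D a = v * rmass w D a.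
Hypothesis eb : (1 - (1 - v)) * lmass w D b = (1 - v) * rmass w D b.

(** Reflection maps the balance point for 1 - v to one for v, and the latter
    is unique: b = D - a. *)
Lemma balance_reflect : lmass w D b = rmass w D a /\ rmass w D b = lmass w D a.
Proof.
have Db : 0 < D - b < D by move: bD; lra.
have rDb : rmass w D (D - b) = lmass w D b.
  by rewrite (rmass_lmass hw Db) opprB addrCA subrr addr0.
have -> : a = D - b.
  apply: (balance_unique hw v01 aD Db ea).
  by rewrite rDb -(rmass_lmass hw bD) -eb; congr (_ * _); ring.
by rewrite rDb (rmass_lmass hw bD).
Qed.

(** By [balance_reflect] the slack at b bounds the constants of the slack at a
    with the roles of left and right exchanged, so that common constants
    l < L and r < M serve for both. As (L + M)^-1 is equal to v / L and to
    (1 - v) / M, the smaller one of v / l and (1 - v) / (r + k) exceeds it when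
    k is small. *)
Lemma iso_profile_gap :
  has_slack D h (lmass w D a) (rmass w D a) ->
  has_slack D h (lmass w D b) (rmass w D b) ->
  exists2 c : R, (lmass w D a + rmass w D a)^-1 < c &
    (c%:E <= iso_profile D h v)%E.
Proof.
have [-> ->] := balance_reflect.
have L0 : 0 < lmass w D a by exact: (lmass_gt0 hw aD).
have M0 : 0 < rmass w D a by exact: (rmass_gt0 hw aD).
move: ea L0 M0; move: (lmass w D a) (rmass w D a) => L M eLM L0 M0.
move=> [t [e1 [l1 [r1 [e10 l1L r1M lt1 rt1]]]]] [s [e2 [r2 [l2 [e20 r2M l2L ls2 rs2]]]]].
have [l [ll1 ll2 l0 lL]] : exists l, [/\ l1 <= l, l2 <= l, 0 < l & l < L].
  by exists (Num.max l1 l2); rewrite !le_max !lexx orbT lt_max gt_max; split => //; lra.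
have [r [rr1 rr2 r0 rM]] : exists r, [/\ r1 <= r, r2 <= r, 0 < r & r < M].
  by exists (Num.max r1 r2); rewrite !le_max !lexx orbT lt_max gt_max; split => //; lra.
have [k [ke1 ke2 k0 rkM]] : exists k, [/\ k <= e1, k <= e2, 0 < k & r + k < M].
  pose k3 := (M - r) / 2.
  exists (Num.min e1 (Num.min e2 k3)).
  have k3r : r + k3 < M by rewrite /k3; lra.
  have mk3 : Num.min e1 (Num.min e2 k3) <= k3 by rewrite !ge_min lexx !orbT.
  rewrite !ge_min !lexx !orbT !lt_min e10 e20/=; split => //; first by rewrite /k3; lra.
  exact: le_lt_trans (lerD (lexx r) mk3) k3r.
have /andP[v0 v1] := v01.
have LM0 : 0 < L + M by rewrite addr_gt0.
have vE : v = L / (L + M) by apply: (canRL (mulfK _)); [rewrite gt_eqF|lra].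
have c0L : (L + M)^-1 = v / L by rewrite vE; field; rewrite !gt_eqF.
have c0M : (L + M)^-1 = (1 - v) / M by rewrite vE; field; rewrite !gt_eqF.
pose c := Num.min (v / l) ((1 - v) / (r + k)).
have rk0 : 0 < r + k by rewrite addr_gt0.
have cl : c * l <= v by rewrite -ler_pdivlMr// ge_min lexx.
have cr : c * (r + k) <= 1 - v by rewrite -ler_pdivlMr// ge_min lexx orbT.
have c0 : (L + M)^-1 < c.
  rewrite lt_min {1}c0L c0M; apply/andP; split.
    by rewrite ltr_pM2l// ltf_pV2 ?posrE.
  by rewrite ltr_pM2l ?subr_gt0// ltf_pV2 ?posrE.
exists c => //; apply: le_ereal_inf_tmp => _ [A [mA AD mAv] <-].
have {}mAv : mass D h A = v by rewrite /mass mAv.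
have c00 : 0 <= c by rewrite (le_trans _ (ltW c0))// invr_ge0 ltW.
apply: (@outer_minkowski_ge _ _ _ k) => // e /andP[e0 ek].
rewrite (quotient_massE ch)// lee_fin ler_pdivlMr// mulrC.
have h0' y x z : 0 <= y <= D -> x <= z -> x * h y <= z * h y.
  by move=> yD xz; rewrite ler_wpM2r// h0.
apply: (@mass_enlargement_ge _ D h ch h0 h1 A v l r t s k e c) => //.
- by rewrite e0.
- move=> y yD yt; apply: le_trans (h0' _ _ _ yD ll1); apply: lt1 => //; lra.
- by move=> y yD yt; apply: le_trans (h0' _ _ _ yD rr1); apply: rt1.
- move=> y yD yt; apply: le_trans (h0' _ _ _ yD rr2); apply: ls2 => //; lra.
- by move=> y yD yt; apply: le_trans (h0' _ _ _ yD ll2); apply: rs2.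
Qed.

End gap.

Lemma density_measure_profile (R : realType) (D : R) (w : R -> R) (a : R) :
  mcp_weight D w -> 0 < a < D -> density_measure D (profile w D a) `[0, D] = 1%E.
Proof.
move=> hw aD; rewrite (density_measureE (profile_continuous hw aD))// mass_itv//.
by rewrite (Rintegral_profile hw aD).
Qed.

(** The segment [0, a] has mass v by the balance equation, and its outer
    Minkowski content is at most the value of the profile at a, by continuity. *)
Lemma iso_profile_profile_le (R : realType) (D : R) (w : R -> R) (v a : R) :
  mcp_weight D w -> 0 < a < D ->
  (1 - v) * lmass w D a = v * rmass w D a ->
  (iso_profile D (profile w D a) v <= (lmass w D a + rmass w D a)^-1%:E)%E.
Proof.
move=> hw aD /(balance_fraction hw aD) ea; have /andP[a0 ltaD] := aD.
have cp := profile_continuous hw aD.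
have p0 x (_ : 0 <= x <= D) := profile_ge0 hw aD x.
apply/lee_addgt0Pr => e e0.
have [|k k0 [akD hk]] := @profile_near _ _ _ _ hw aD ((lmass w D a + rmass w D a)^-1 + e).
  by rewrite ltrDl.
apply: le_trans (outer_minkowski_initial_le cp p0 a0 akD k0 hk).
apply: ereal_inf_lbound; exists `[0, a]%classic => //; split => //.
  by move=> x /=; rewrite !in_itv/=; lra.
rewrite density_measureE// mass_itv; last first.
  by move=> x /=; rewrite !in_itv/=; lra.
by rewrite (Rintegral_profile_left a hw) ea.
Qed.

Unset Implicit Arguments.

Theorem theorem3p11 (R : realType) (K N D : R) (h : R -> R)
  (hN : 1 < N) (hD : 0 < D)
  (hKD : 0 < K -> D <= pi * Num.sqrt ((N - 1) / K))
  (hh : MCP_density K N D h)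
  (hint : density_measure D h `[0, D] = 1%E)
  (v : R) (hv : 0 < v < 1)
  (hiso : iso_profile D h v = MCP_iso_profile K N D v) :
  {in `[0, D], h =1 h_ K N D (a_ K N D v)} \/
  {in `[0, D], h =1 h_ K N D (a_ K N D (1 - v))}.
Proof.
have hw := s_weight_mcp hN hKD.
have [_ ch h0' _] := hh.
have h0 x : 0 <= x <= D -> 0 <= h x by move=> xD; apply: h0'; rewrite in_itv.
have hcmp := MCP_comparison hw (sigma_weight hN hKD) hh.
have hv' : 0 < 1 - v < 1 by lra.
have [aD ea] := a_balance hN hD hKD hv.
have [bD eb] := a_balance hN hD hKD hv'.
have m1 : mass D h `[0, D] = 1 by rewrite /mass hint.
have i1 : \int[@lebesgue_measure R]_(x in `[0, D]) h x = 1.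
  by rewrite -m1 mass_itv.
have [sa|ra] := slack_or_rigid hw aD hcmp ch h0 i1; last first.
  left=> x; rewrite in_itv/= => xD.
  exact: etrans (ra _ xD) (esym (h_profileE hN hKD aD xD)).
have [sb|rb] := slack_or_rigid hw bD hcmp ch h0 i1; last first.
  right=> x; rewrite in_itv/= => xD.
  exact: etrans (rb _ xD) (esym (h_profileE hN hKD bD xD)).
exfalso.
have [c cgt] := iso_profile_gap hw ch h0 m1 hv aD bD ea eb sa sb.
rewrite hiso leNgt => /negP; apply.
apply: (@le_lt_trans _ _ (iso_profile D (profile (s_weight K N) D (a_ K N D v)) v)).
  apply: ereal_inf_lbound; exists (profile (s_weight K N) D (a_ K N D v)); last by [].
  split; first exact: (profile_MCP hN hw (sigma_weight hN hKD) aD).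
  exact: (density_measure_profile hw aD).
apply: (le_lt_trans (iso_profile_profile_le hw aD ea)).
by rewrite lte_fin.
Qed.
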